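(* Let $d>1$ and let $G=(V,E)$ be an unknown straight-line embedded graph in $\mathbb{R}^d$ with $n=|V|$ vertices satisfying the general position assumption: no two distinct vertices share any coordinate value $x_i$, $i\in\{1,\dots,d\}$, and no three vertices are collinear after projection to the subspace spanned by the standard basis vectors $e_1,e_2$. Given an oracle returning directional augmented persistence diagrams of $G$, the vertex set $V$, the edge set $E$, and the embedding of $G$ can be computed using augmented persistence diagrams from $n^2-n+d+1$ different directions in time $O\big(dn^{d+1}+n^4+(d+n^2)T_G\big)$, where $\Theta(T_G)$ is the time complexity of computing a single diagram.
   Context: A straight-line embedded graph in $\mathbb{R}^d$ is a finite simple graph with vertex set $V\subset\mathbb{R}^d$ whose edges are straight segments between pairs of vertices, embedded (for $d=2$: a plane graph, i.e. no two edges cross). For a unit vector $s\in\mathbb{S}^{d-1}$, the height of a simplex (vertex or edge) $\sigma$ is $h_s(\sigma)=\max_{v\in\sigma} v\cdot s$, and the height (lower-star) filtration in direction $s$ is the family of subgraphs $G_t=h_s^{-1}((-\infty,t])$, $t\in\mathbb{R}$. Augmented persistence diagram (APD) in direction $s$, $\mathrm{Dgm}(s)$: order the simplices compatibly with $h_s$ (nondecreasing height, vertices before the edges containing them) and add them one at a time. Each vertex gives birth to a $0$-dimensional class; each edge either merges two components (killing a $0$-dimensional class, paired as usual by the elder rule) or creates a $1$-cycle (birth of a $1$-dimensional class, which never dies). The APD is the finite multiset of all resulting pairs (birth height, death height), each labelled with its dimension $0$ or $1$, with death $=\infty$ if the class never dies; unlike in the ordinary persistence diagram, pairs with equal birth and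 death heights are retained with their multiplicity. All dimensions for one direction together count as one diagram. The oracle takes a direction $s\in\mathbb{S}^{d-1}$ and returns $\mathrm{Dgm}(s)$ in $\Theta(T_G)$ time. Arithmetic on real numbers takes constant time. *)

(* Defs.v *)
From HB Require Import structures.
From mathcomp Require Import all_boot all_order all_fingroup all_algebra.
From mathcomp Require Import constructive_ereal reals.

Set Implicit Arguments.
Unset Strict Implicit.
Unset Printing Implicit Defensive.

Import Order.TTheory GRing.Theory Num.Theory.

Local Open Scope ring_scope.

(** * Straight-line embedded graphs *)

(* The norms that the libraries put on row vectors are not Euclidean, so the
   unit sphere is defined from the standard inner product. *)
Definition dot (R : realType) (d : nat) (u v : 'rV[R]_d) : R :=
  \sum_(i < d) u 0 i * v 0 i.

Definition sphere (R : realType) (d : nat) (s : 'rV[R]_d) : Prop :=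
  dot s s = 1.

Definition segment (R : realType) (d : nat) (a b p : 'rV[R]_d) : Prop :=
  exists t : R, 0 <= t <= 1 /\ p = (1 - t) *: a + t *: b.

(* The vertex set V is the image of the injection [pos]; an edge is a set of
   two vertices.  The last two fields say that the induced map from the
   topological graph to R^d is injective. *)
Record egraph (R : realType) (d : nat) := EGraph {
  nv : nat;
  pos : 'I_nv -> 'rV[R]_d;
  edges : {set {set 'I_nv}};
  pos_inj : injective pos;
  edges_card2 : forall e, e \in edges -> #|e| = 2%N;
  edges_vertex : forall a b v : 'I_nv, [set a; b] \in edges ->
    segment (pos a) (pos b) (pos v) -> v \in [set a; b];
  edges_cross : forall (a b a' b' : 'I_nv) (p : 'rV[R]_d),
    [set a; b] \in edges -> [set a'; b'] \in edges ->
    [set a; b] != [set a'; b'] ->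
    segment (pos a) (pos b) p -> segment (pos a') (pos b') p ->
    exists2 v, v \in [set a; b] :&: [set a'; b'] & p = pos v
}.

Definition collinear2 (R : realType) (p q r : R * R) : Prop :=
  exists a b c : R,
    [/\ (a, b) != (0, 0), a * p.1 + b * p.2 = c,
        a * q.1 + b * q.2 = c & a * r.1 + b * r.2 = c].

Definition general_position (R : realType) (d : nat) (G : egraph R d) : Prop :=
  (forall (u v : 'I_(nv G)) (i : 'I_d), u != v -> pos u 0 i != pos v 0 i) /\
  (forall (i0 i1 : 'I_d) (u v w : 'I_(nv G)),
     i0 = 0%N :> nat -> i1 = 1%N :> nat -> uniq [:: u; v; w] ->
     ~ collinear2 (pos u 0 i0, pos u 0 i1) (pos v 0 i0, pos v 0 i1)
                  (pos w 0 i0, pos w 0 i1)).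

(** * Augmented persistence diagrams *)

Definition simplices (R : realType) (d : nat) (G : egraph R d) :
    {set {set 'I_(nv G)}} :=
  [set [set v] | v : 'I_(nv G)] :|: edges G.

(* The maximum is seeded with the head of the list, so that for nonempty
   [sigma] it is the maximum of the listed values even if all are negative. *)
Definition height (R : realType) (d : nat) (G : egraph R d) (s : 'rV[R]_d)
    (sigma : {set 'I_(nv G)}) : R :=
  let hs := [seq dot (pos v) s | v <- enum sigma] in
  \big[Num.max/head 0 hs]_(h <- hs) h.

Arguments height {R d} G s sigma.

Definition compatible (R : realType) (d : nat) (G : egraph R d) (s : 'rV[R]_d)
    (ord : seq {set 'I_(nv G)}) : Prop :=
  [/\ perm_eq ord (enum (simplices G)),
      sorted (fun sigma tau => height G s sigma <= height G s tau) ord &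
      forall (v : 'I_(nv G)) (e : {set 'I_(nv G)}), e \in edges G -> v \in e ->
        (index [set v] ord < index e ord)%N].

Arguments compatible {R d} G s ord.

(* (birth, death, dimension) *)
Definition dgm_point (R : realType) : Type := (R * \bar R * nat)%type.

(* [filt_comps] lists the connected components of the current subgraph, each
   with its birth height, from the oldest to the youngest; [filt_closed] lists
   the pairs that are already final. *)
Record filt_state (R : realType) (V : finType) := FiltState {
  filt_comps : seq (R * {set V});
  filt_closed : seq (dgm_point R)
}.

(* An edge meets either one component, and creates a cycle, or two, and then
   the younger one, which comes second in the list, dies (elder rule). *)
Definition add_simplex (R : realType) (d : nat) (G : egraph R d)
    (s : 'rV[R]_d) (st : filt_state R 'I_(nv G)) (sigma : {set 'I_(nv G)}) :
    filt_state R 'I_(nv G) :=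
  let: FiltState comps closed := st in
  let h := height G s sigma in
  if #|sigma| == 1%N then FiltState (rcons comps (h, sigma)) closed
  else if [seq c : R * {set 'I_(nv G)} <- comps
             | ~~ [disjoint c.2 & sigma]] is [:: old; young] then
    FiltState
      [seq if c == old then (old.1, old.2 :|: young.2) else c
         | c <- rem young comps]
      (rcons closed (young.1, h%:E, 0%N))
  else FiltState comps (rcons closed (h, +oo%E, 1%N)).

Arguments add_simplex {R d} G s st sigma.

Definition apd_of_order (R : realType) (d : nat) (G : egraph R d)
    (s : 'rV[R]_d) (ord : seq {set 'I_(nv G)}) : seq (dgm_point R) :=
  let st := foldl (add_simplex G s) (FiltState [::] [::]) ord in
  filt_closed st ++ [seq (c.1, +oo%E, 0%N) | c <- filt_comps st].

Arguments apd_of_order {R d} G s ord.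

(* [D] lists the multiset Dgm(s), in any order; this multiset does not depend
   on the compatible order chosen. *)
Definition is_apd (R : realType) (d : nat) (G : egraph R d) (s : 'rV[R]_d)
    (D : seq (dgm_point R)) : Prop :=
  exists2 ord, compatible G s ord & perm_eq D (apd_of_order G s ord).

Definition apd_oracle (R : realType) (d : nat) (G : egraph R d)
    (orc : 'rV[R]_d -> seq (dgm_point R)) : Prop :=
  forall s, sphere s -> is_apd G s (orc s).

(** * A real RAM with an oracle *)

(* The memory consists of arrays of natural numbers and arrays of reals, both
   named by natural numbers.  Natural numbers serve as counters and addresses:
   they are only added and subtracted (truncated), never multiplied, and no
   instruction converts between naturals and reals. *)
Inductive nexp : Type :=
| NLit of nat
| NGet of nat & nexp
| NAdd of nexp & nexp
| NSub of nexp & nexp.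

(* Square roots are needed to normalize query directions. *)
Inductive rexp : Type :=
| RLit of nat
| RGet of nat & nexp
| RAdd of rexp & rexp
| RSub of rexp & rexp
| RMul of rexp & rexp
| RDiv of rexp & rexp
| RSqrt of rexp.

Inductive bexp : Type :=
| BEqN of nexp & nexp
| BLtN of nexp & nexp
| BEqR of rexp & rexp
| BLtR of rexp & rexp
| BNot of bexp
| BAnd of bexp & bexp.

Inductive cmd : Type :=
| Skip
| NSet of nat & nexp & nexp
| RSet of nat & nexp & rexp
| Seq of cmd & cmd
| If of bexp & cmd & cmd
| While of bexp & cmd
| Query.

Record memory (R : realType) := Memory {
  nmem : nat -> nat -> nat;
  rmem : nat -> nat -> R
}.

Fixpoint neval (R : realType) (m : memory R) (e : nexp) : nat :=
  match e with
  | NLit k => k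
  | NGet a i => nmem m a (neval m i)
  | NAdd e1 e2 => (neval m e1 + neval m e2)%N
  | NSub e1 e2 => (neval m e1 - neval m e2)%N
  end.

Fixpoint reval (R : realType) (m : memory R) (e : rexp) : R :=
  match e with
  | RLit k => k%:R
  | RGet a i => rmem m a (neval m i)
  | RAdd e1 e2 => reval m e1 + reval m e2
  | RSub e1 e2 => reval m e1 - reval m e2
  | RMul e1 e2 => reval m e1 * reval m e2
  | RDiv e1 e2 => reval m e1 / reval m e2
  | RSqrt e1 => Num.sqrt (reval m e1)
  end.

Fixpoint beval (R : realType) (m : memory R) (b : bexp) : bool :=
  match b with
  | BEqN e1 e2 => neval m e1 == neval m e2
  | BLtN e1 e2 => (neval m e1 < neval m e2)%N
  | BEqR e1 e2 => reval m e1 == reval m e2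
  | BLtR e1 e2 => reval m e1 < reval m e2
  | BNot b1 => ~~ beval m b1
  | BAnd b1 b2 => beval m b1 && beval m b2
  end.

(* Evaluating an expression takes one unit of time per node. *)
Fixpoint ncost (e : nexp) : nat :=
  match e with
  | NLit _ => 1%N
  | NGet _ i => (ncost i).+1
  | NAdd e1 e2 | NSub e1 e2 => (ncost e1 + ncost e2).+1%N
  end.

Fixpoint rcost (e : rexp) : nat :=
  match e with
  | RLit _ => 1%N
  | RGet _ i => (ncost i).+1
  | RAdd e1 e2 | RSub e1 e2 | RMul e1 e2 | RDiv e1 e2 =>
      (rcost e1 + rcost e2).+1%N
  | RSqrt e1 => (rcost e1).+1
  end.

Fixpoint bcost (b : bexp) : nat :=
  match b with
  | BEqN e1 e2 | BLtN e1 e2 => (ncost e1 + ncost e2).+1%N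
  | BEqR e1 e2 | BLtR e1 e2 => (rcost e1 + rcost e2).+1%N
  | BNot b1 => (bcost b1).+1
  | BAnd b1 b2 => (bcost b1 + bcost b2).+1%N
  end.

Definition upd (X : Type) (f : nat -> nat -> X) (a i : nat) (x : X) :
    nat -> nat -> X :=
  fun a' i' => if (a' == a) && (i' == i) then x else f a' i'.

(* Input and output conventions.
   - nat array 0, cell 0: the dimension d;
   - real array 0: the direction passed to the oracle, d coordinates;
   - nat array 1, cell 0: the number of points of the returned diagram;
     the k-th point has its birth in cell k of real array 1, its death (if
     finite) in cell k of real array 2, the flag "death is infinite" in cell k
     of nat array 2 and its dimension in cell k of nat array 3;
   - nat array 4, cells 0 and 1: the reconstructed numbers of vertices and of
     edges;
   - real array 3: the coordinates of the reconstructed vertices, d per vertex;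
   - nat arrays 5 and 6, cell k: the two endpoints of the k-th edge, as indices
     of reconstructed vertices. *)
Definition init_mem (R : realType) (d : nat) : memory R :=
  Memory (upd (fun _ _ => 0%N) 0%N 0%N d) (fun _ _ => 0).

Definition query_dir (R : realType) (d : nat) (m : memory R) : 'rV[R]_d :=
  \row_(j < d) rmem m 0%N j.

Definition load_dgm (R : realType) (D : seq (dgm_point R)) (m : memory R) :
    memory R :=
  let pt k := nth (0, +oo%E, 0%N) D k in
  Memory
    (fun a k =>
       if (a == 1%N) && (k == 0%N) then size D
       else if (a == 2%N) && (k < size D)%N then nat_of_bool ((pt k).1.2 == +oo%E)
       else if (a == 3%N) && (k < size D)%N then (pt k).2
       else nmem m a k)
    (fun a k =>
       if (a == 1%N) && (k < size D)%N then (pt k).1.1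
       else if (a == 2%N) && (k < size D)%N then fine (pt k).1.2
       else rmem m a k).

(* [exec orc tau c m m' tr t]: with oracle [orc], whose answer to [s] takes
   time [tau s], the command [c] started in memory [m] halts in memory [m']
   after time [t], having queried the directions [tr] in this order.  The
   relation is deterministic; a query of a vector off the sphere is stuck. *)
Inductive exec (R : realType) (d : nat) (orc : 'rV[R]_d -> seq (dgm_point R))
    (tau : 'rV[R]_d -> nat) :
    cmd -> memory R -> memory R -> seq 'rV[R]_d -> nat -> Prop :=
| ExecSkip m : exec orc tau Skip m m [::] 1%N
| ExecNSet m a i e :
    exec orc tau (NSet a i e) m
      (Memory (upd (nmem m) a (neval m i) (neval m e)) (rmem m))
      [::] (ncost i + ncost e).+1%N
| ExecRSet m a i e :
    exec orc tau (RSet a i e) m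
      (Memory (nmem m) (upd (rmem m) a (neval m i) (reval m e)))
      [::] (ncost i + rcost e).+1%N
| ExecSeq c1 c2 m1 m2 m3 tr1 tr2 t1 t2 :
    exec orc tau c1 m1 m2 tr1 t1 -> exec orc tau c2 m2 m3 tr2 t2 ->
    exec orc tau (Seq c1 c2) m1 m3 (tr1 ++ tr2) (t1 + t2)%N
| ExecIf b c1 c2 m m' tr t :
    exec orc tau (if beval m b then c1 else c2) m m' tr t ->
    exec orc tau (If b c1 c2) m m' tr (bcost b + t).+1%N
| ExecWhileDone b c m :
    ~~ beval m b -> exec orc tau (While b c) m m [::] (bcost b).+1
| ExecWhileStep b c m1 m2 m3 tr1 tr2 t1 t2 :
    beval m1 b -> exec orc tau c m1 m2 tr1 t1 ->
    exec orc tau (While b c) m2 m3 tr2 t2 ->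
    exec orc tau (While b c) m1 m3 (tr1 ++ tr2) (bcost b + t1 + t2).+1%N
| ExecQuery m :
    sphere (query_dir d m) ->
    exec orc tau Query m (load_dgm (orc (query_dir d m)) m)
      [:: query_dir d m] (tau (query_dir d m)).+1.

(* The output lists every vertex, with its position, and every edge exactly
   once; [phi] is the order in which the vertices are listed. *)
Definition reconstructs (R : realType) (d : nat) (G : egraph R d)
    (m : memory R) : Prop :=
  nmem m 4%N 0%N = nv G /\
  exists phi : 'S_(nv G),
    (forall (i : 'I_(nv G)) (j : 'I_d),
       rmem m 3%N (i * d + j)%N = pos (phi i) 0 j) /\
    exists L : seq ('I_(nv G) * 'I_(nv G)),
      [/\ nmem m 4%N 1%N = size L,
          forall k, (k < size L)%N ->
            (nmem m 5%N k, nmem m 6%N k)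
              = nth (0%N, 0%N) [seq (val p.1, val p.2) | p <- L] k &
          perm_eq [seq [set phi p.1; phi p.2] | p <- L] (enum (edges G))].

(* Main.v *)
Require Import Defs.
From HB Require Import structures.
From mathcomp Require Import all_boot all_order all_fingroup all_algebra.
From mathcomp Require Import constructive_ereal reals.
From mathcomp Require Import zify ring lra.

Set Implicit Arguments.
Unset Strict Implicit.
Unset Printing Implicit Defensive.

Import Order.TTheory GRing.Theory Num.Theory.

Local Open Scope ring_scope.

(* The d axes give, for each coordinate, the list of its n values.  If S
   dominates all |x| and all 1/|x - x'| for these values, then a point with
   coordinates x_j in the lists is determined by its height sum_j eps^j x_j with
   eps = 1 / (2 + 4 S^2): the first coordinate is the only list entry at distance
   less than 1/(2S) from that height, and one continues with the remainder divided
   by eps.  So the query (1, eps, eps^2, ...), normalized, yields all vertices.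

   The number of edges whose upper end is at height h is the number of diagram
   points that are 1-dimensional and born at h, or 0-dimensional and die at h.
   In direction (1, t), suitably normalized, vertices u and v have equal height
   for exactly one slope t_uv, and by general position t_uv differs from t_wv for
   all other w.  Between t_uv - delta and t_uv + delta with delta small, u and v
   are thus exchanged while the order of v and the other vertices is preserved,
   so the number of edges with upper end v changes iff uv is an edge.  Two
   queries per pair of vertices give n^2 - n queries; they are pairwise distinct
   if delta also separates t_uv from the previously queried slopes. *)

(** * Program logic for the real RAM *)

(** Arrays that a run may write, read off the syntax. For [Query] these are the arrays filled by
    [load_dgm]. *)
Fixpoint nmods (c : cmd) : seq nat :=
  match c with
  | Skip | RSet _ _ _ => [::]
  | NSet a _ _ => [:: a]
  | Seq c1 c2 | If _ c1 c2 => nmods c1 ++ nmods c2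
  | While _ c1 => nmods c1
  | Query => [:: 1%N; 2%N; 3%N]
  end.

Fixpoint rmods (c : cmd) : seq nat :=
  match c with
  | Skip | NSet _ _ _ => [::]
  | RSet a _ _ => [:: a]
  | Seq c1 c2 | If _ c1 c2 => rmods c1 ++ rmods c2
  | While _ c1 => rmods c1
  | Query => [:: 1%N; 2%N]
  end.

(** Commands without loops and queries always halt, so their effect is computed by [flat_mem] and
    reasoning about them is simplification. *)
Fixpoint flat (c : cmd) : bool :=
  match c with
  | Skip | NSet _ _ _ | RSet _ _ _ => true
  | Seq c1 c2 | If _ c1 c2 => flat c1 && flat c2
  | While _ _ | Query => false
  end.

Fixpoint flat_mem (R : realType) (c : cmd) (m : memory R) : memory R :=
  match c with
  | NSet a i e => Memory (upd (nmem m) a (neval m i) (neval m e)) (rmem m)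
  | RSet a i e => Memory (nmem m) (upd (rmem m) a (neval m i) (reval m e))
  | Seq c1 c2 => flat_mem c2 (flat_mem c1 m)
  | If b c1 c2 => if beval m b then flat_mem c1 m else flat_mem c2 m
  | _ => m
  end.

(** Both branches of [If] are charged, which makes the bound independent of the memory. *)
Fixpoint flat_cost (c : cmd) : nat :=
  match c with
  | Skip => 1
  | NSet _ i e => (ncost i + ncost e).+1
  | RSet _ i e => (ncost i + rcost e).+1
  | Seq c1 c2 => flat_cost c1 + flat_cost c2
  | If b c1 c2 => (bcost b + (flat_cost c1 + flat_cost c2)).+1
  | _ => 0
  end.

Definition nvar (a : nat) : nexp := NGet a (NLit 0).
Definition rvar (a : nat) : rexp := RGet a (NLit 0).
Definition nset (a : nat) (e : nexp) : cmd := NSet a (NLit 0) e.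
Definition rset (a : nat) (e : rexp) : cmd := RSet a (NLit 0) e.
Definition incr (a : nat) : cmd := nset a (NAdd (nvar a) (NLit 1)).
Definition For (i b : nat) (c : cmd) : cmd :=
  Seq (nset i (NLit 0)) (While (BLtN (nvar i) (nvar b)) (Seq c (incr i))).

Declare Scope cmd_scope.
Delimit Scope cmd_scope with cmd.
Notation "c1 ;; c2" := (Seq c1%cmd c2%cmd)
  (at level 100, right associativity) : cmd_scope.

Definition frame (R : realType) (ns rs : seq nat) (m m' : memory R) : Prop :=
  (forall a i, a \notin ns -> nmem m' a i = nmem m a i) /\
  (forall a i, a \notin rs -> rmem m' a i = rmem m a i).

Definition setn (R : realType) (m : memory R) (a v : nat) : memory R :=
  Memory (upd (nmem m) a 0%N v) (rmem m).

Section Frame.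
Variable R : realType.
Implicit Types (m : memory R) (ns rs : seq nat).

Lemma frame_refl ns rs m : frame ns rs m m.
Proof. by split. Qed.

Lemma frame_trans ns rs m1 m2 m3 :
  frame ns rs m1 m2 -> frame ns rs m2 m3 -> frame ns rs m1 m3.
Proof.
move=> [n1 r1] [n2 r2]; split=> a i ai.
  by rewrite n2 ?n1.
by rewrite r2 ?r1.
Qed.

Lemma frame_sub ns rs ns' rs' m m' : {subset ns <= ns'} -> {subset rs <= rs'} ->
  frame ns rs m m' -> frame ns' rs' m m'.
Proof.
move=> sn sr [n1 r1]; split=> a i ai; first by apply: n1; apply: contra ai => /sn.
by apply: r1; apply: contra ai => /sr.
Qed.

Lemma frame_nmem ns rs m m' a i :
  frame ns rs m m' -> a \notin ns -> nmem m' a i = nmem m a i.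
Proof. by case=> + _; apply. Qed.

Lemma frame_rmem ns rs m m' a i :
  frame ns rs m m' -> a \notin rs -> rmem m' a i = rmem m a i.
Proof. by case=> _; apply. Qed.

Lemma frame_setn ns rs m i v : i \in ns -> frame ns rs m (setn m i v).
Proof.
move=> ni; split=> a k ak //=; rewrite /upd; case: eqP => // e.
by rewrite e ni in ak.
Qed.

End Frame.

Section Runs.
Variables (R : realType) (d : nat).
Variables (orc : 'rV[R]_d -> seq (dgm_point R)) (tau : 'rV[R]_d -> nat).
Implicit Types (m : memory R) (c : cmd) (tr : seq 'rV[R]_d).

Lemma exec_frame c m m' tr t :
  exec orc tau c m m' tr t -> frame (nmods c) (rmods c) m m'.
Proof.
elim=> {c m m' tr t} /=.
- by move=> m; apply: frame_refl.
- move=> m a i e; split=> // b k; rewrite inE /= /upd => /negbTE ->; by [].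
- move=> m a i e; split=> // b k; rewrite inE /= /upd => /negbTE ->; by [].
- move=> c1 c2 m1 m2 m3 _ _ _ _ _ f1 _ f2; apply: (frame_trans (m2 := m2)).
    by apply: frame_sub f1 => x; rewrite mem_cat => ->.
  by apply: frame_sub f2 => x; rewrite mem_cat orbC => ->.
- move=> b c1 c2 m m' _ _ _; case: (beval m b); apply: frame_sub => x;
    by rewrite mem_cat => ->; rewrite ?orbT.
- by move=> b c m _; apply: frame_refl.
- by move=> b c m1 m2 m3 _ _ _ _ _ _ f1 _ f2; apply: frame_trans f1 f2.
- move=> m _; split=> a i; rewrite !inE !negb_or /=.
    by case/and3P=> /negbTE -> /negbTE -> /negbTE ->.
  by case/andP=> /negbTE -> /negbTE ->.
Qed.

(* [tr] is the trace so far, [B] a time budget. *)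
Definition runs c m tr (B : nat) (Q : memory R -> seq 'rV[R]_d -> Prop) : Prop :=
  exists m' tr' t, [/\ exec orc tau c m m' tr' t, (t <= B)%N & Q m' (tr ++ tr')].

(** The frame follows from the syntax alone, so it is handed to the continuation for free and
    postconditions list only what changes. *)
Lemma runs_weaken c m tr B B' (Q Q' : memory R -> seq 'rV[R]_d -> Prop) :
  runs c m tr B Q -> (B <= B')%N ->
  (forall m' tr', frame (nmods c) (rmods c) m m' -> Q m' tr' -> Q' m' tr') ->
  runs c m tr B' Q'.
Proof.
move=> [m' [tr' [t [ex tB q]]]] BB QQ; exists m', tr', t; split=> //.
  exact: leq_trans BB.
by apply: QQ => //; apply: exec_frame ex.
Qed.

Lemma runs_budget c m tr B B' (Q : memory R -> seq 'rV[R]_d -> Prop) :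
  runs c m tr B Q -> (B <= B')%N -> runs c m tr B' Q.
Proof. by move=> h BB; apply: (runs_weaken h BB). Qed.

Lemma runs_seq c1 c2 m tr B1 B2 Q1 Q :
  runs c1 m tr B1 Q1 ->
  (forall m1 tr1, frame (nmods c1) (rmods c1) m m1 -> Q1 m1 tr1 ->
     runs c2 m1 tr1 B2 Q) ->
  runs (Seq c1 c2) m tr (B1 + B2) Q.
Proof.
move=> [m1 [tr1 [t1 [e1 l1 q1]]]] /(_ _ _ (exec_frame e1) q1).
move=> [m2 [tr2 [t2 [e2 l2 q2]]]].
exists m2, (tr1 ++ tr2), (t1 + t2)%N; split; first exact: ExecSeq e1 e2.
  exact: leq_add.
by rewrite catA.
Qed.

Lemma exec_flat c m : flat c ->
  exists2 t, exec orc tau c m (flat_mem c m) [::] t & (t <= flat_cost c)%N.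
Proof.
elim: c m => //=.
- by move=> m _; exists 1%N => //; apply: ExecSkip.
- by move=> a i e m _; eexists; first exact: ExecNSet.
- by move=> a i e m _; eexists; first exact: ExecRSet.
- move=> c1 I1 c2 I2 m /andP[f1 f2].
  have [t1 e1 l1] := I1 m f1; have [t2 e2 l2] := I2 (flat_mem c1 m) f2.
  exists (t1 + t2)%N; last exact: leq_add.
  by rewrite -[[::]]/([::] ++ [::] : seq 'rV[R]_d); apply: ExecSeq e1 e2.
- move=> b c1 I1 c2 I2 m /andP[f1 f2].
  have [t1 e1 l1] := I1 m f1; have [t2 e2 l2] := I2 m f2.
  case E: (beval m b).
    exists (bcost b + t1).+1; last by lia.
    by apply: ExecIf; rewrite E.
  exists (bcost b + t2).+1; last by lia.
  by apply: ExecIf; rewrite E.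
Qed.

Lemma runs_flat c m tr (Q : memory R -> seq 'rV[R]_d -> Prop) :
  flat c -> Q (flat_mem c m) tr -> runs c m tr (flat_cost c) Q.
Proof.
move=> fc q; have [t e l] := exec_flat m fc.
by exists (flat_mem c m), [::], t; rewrite cats0.
Qed.

Lemma runs_query m tr B (Q : memory R -> seq 'rV[R]_d -> Prop) s :
  query_dir d m = s -> sphere s -> (tau s <= B)%N ->
  Q (load_dgm (orc s) m) (rcons tr s) -> runs Query m tr B.+1 Q.
Proof.
move=> <- ss tB q; exists (load_dgm (orc (query_dir d m)) m), [:: query_dir d m],
  (tau (query_dir d m)).+1; split=> //; first exact: ExecQuery.
by rewrite cats1.
Qed.

(** Each round costs 12 beyond the body, 6 for the test and 6 for the increment; the 9 pays for the
    initialization (3) and the failing last test (6). The frame relative to [m0] is carried along,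
    so the invariant need only speak of cells that the body writes. *)
Lemma runs_for i b c m0 tr0 nb B
    (I : nat -> memory R -> seq 'rV[R]_d -> Prop) :
  i \notin nmods c -> b \notin i :: nmods c -> nmem m0 b 0%N = nb ->
  I 0%N (setn m0 i 0) tr0 ->
  (forall k m tr, (k < nb)%N -> nmem m i 0%N = k ->
     frame (i :: nmods c) (rmods c) m0 m -> I k m tr ->
     runs c m tr B (fun m' tr' => I k.+1 (setn m' i k.+1) tr')) ->
  runs (For i b c) m0 tr0 (nb * (B + 12) + 9) (I nb).
Proof.
move=> ic bc bE I0 step; rewrite addnC -[9%N]/(3 + 6)%N -addnA.
apply: (runs_seq (Q1 := fun m tr => m = setn m0 i 0 /\ tr = tr0)).
  exact: runs_flat.
move=> _ _ _ [-> ->].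
have : frame (i :: nmods c) (rmods c) m0 (setn m0 i 0).
  by apply: frame_setn; rewrite mem_head.
have : nmem (setn m0 i 0) i 0%N = 0%N by rewrite /= /upd !eqxx.
move: (setn m0 i 0) tr0 I0 => ma tra I0 kia fra.
(* Induction on the number [j] of rounds left. *)
suff gen j : forall k m tr, (nb - k)%N = j -> (k <= nb)%N ->
    nmem m i 0%N = k -> frame (i :: nmods c) (rmods c) m0 m -> I k m tr ->
    runs (While (BLtN (nvar i) (nvar b)) (Seq c (incr i))) m tr (6 + j * (B + 12)) (I nb).
  by apply: (gen _ 0%N) => //; rewrite subn0.
elim: j => [|j IH] k m tr E kn ki fr Ik.
  have -> : nb = k by lia.
  rewrite mul0n addn0; exists m, [::], 6%N; split=> //.
    apply: ExecWhileDone; rewrite /= ki (frame_nmem _ fr) // bE; lia.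
  by rewrite cats0.
have kn' : (k < nb)%N by lia.
have [m1 [tr1 [t1 [e1 l1 q1]]]] := step k m tr kn' ki fr Ik.
have f1 := exec_frame e1.
have ki1 : nmem m1 i 0%N = k by rewrite (frame_nmem _ f1).
have E2 : flat_mem (incr i) m1 = setn m1 i k.+1.
  by rewrite /incr /= ki1 /setn addn1.
have [t2 e2 l2] := exec_flat (c := incr i) m1 isT.
rewrite E2 in e2.
have [||||m3 [tr3 [t3 [e3 l3 q3]]]] := IH k.+1 (setn m1 i k.+1) (tr ++ tr1) _ _ _ _ q1.
- by lia.
- by [].
- by rewrite /= /upd !eqxx.
- apply: frame_trans fr _; apply: (frame_trans (m2 := m1)).
    by apply: frame_sub f1 => // x xi; rewrite inE xi orbT.
  by apply: frame_setn; rewrite mem_head.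
exists m3, ((tr1 ++ [::]) ++ tr3), (5 + (t1 + t2) + t3).+1; split.
- apply: ExecWhileStep e3; last exact: ExecSeq e1 e2.
  by rewrite /= ki (frame_nmem _ fr) // bE.
- by move: l2 => /=; lia.
- by rewrite cats0 catA.
Qed.

End Runs.

(** * Counting simplices in a diagram *)

Definition births0 (R : realType) (D : seq (dgm_point R)) : seq R :=
  [seq p.1.1 | p <- D & p.2 == 0%N].

(** An edge either creates a cycle, which is born at its height, or merges two components, one of
    which dies at its height. Infinite deaths are excluded explicitly because [fine] sends them to
    0, which may equal [h]. *)
Definition edge_event (R : realType) (h : R) (p : dgm_point R) : bool :=
  if p.2 == 1%N then p.1.1 == h
  else [&& p.2 == 0%N, p.1.2 != +oo%E & fine p.1.2 == h].

Lemma mem_filter_pair (T : eqType) (a : pred T) (s : seq T) x y :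
  [seq z <- s | a z] = [:: x; y] -> y \in s.
Proof.
move=> E; have : y \in [seq z <- s | a z] by rewrite E !inE eqxx orbT.
by rewrite mem_filter => /andP[].
Qed.

Section Diagrams.
Variables (R : realType) (d : nat) (G : egraph R d) (s : 'rV[R]_d).
Implicit Types (st : filt_state R 'I_(nv G)) (sigma : {set 'I_(nv G)}).

Definition state_births st : seq R :=
  [seq c.1 | c <- filt_comps st] ++ births0 (filt_closed st).

Lemma map_merge (old : R * {set 'I_(nv G)}) B (cs : seq (R * {set 'I_(nv G)})) :
  [seq c.1 | c <- [seq if c == old then (old.1, B) else c | c <- cs]]
  = [seq c.1 | c <- cs].
Proof. by rewrite -map_comp; apply: eq_map => c /=; case: eqP => [->|]. Qed.

(** A merge moves the birth of the younger component from the open list to the closed pairs, and a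
    cycle adds no 0-dimensional birth; only a vertex changes the multiset. The comprehension over
    [[:: tt]] is a list of length one or zero. *)
Lemma state_births_add st sigma :
  perm_eq (state_births (add_simplex G s st sigma))
    (state_births st ++
      [seq height G s sigma | _ <- [:: tt] & #|sigma| == 1%N]).
Proof.
case: st => cs cl; rewrite /state_births /add_simplex /=; case: eqP => _ /=.
  by rewrite map_rcons -cats1 -!catA perm_cat2l perm_catC.
rewrite cats0.
case E: [seq _ <- _ | _] => [|old [|young [|? ?]]] /=;
  rewrite /births0 filter_rcons /= ?cats0 //.
have yin := mem_filter_pair E.
rewrite map_rcons /= map_merge -cats1 perm_sym.
rewrite (perm_trans (y := (young.1 :: [seq c.1 | c <- rem young cs]) ++
  [seq p.1.1 | p <- cl & p.2 == 0%N])) //.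
  by rewrite perm_cat2r (perm_map (fun c : R * {set 'I_(nv G)} => c.1) (perm_to_rem yin)).
by rewrite /= catA cats1 perm_sym perm_rcons.
Qed.

Lemma state_births_foldl st ord :
  perm_eq (state_births (foldl (add_simplex G s) st ord))
    (state_births st ++ [seq height G s sigma | sigma <- ord & #|sigma| == 1%N]).
Proof.
elim: ord st => [|sigma ord IH] st /=; first by rewrite cats0.
apply: (perm_trans (IH _)).
rewrite (perm_trans (y := (state_births st ++
  [seq height G s sigma | _ <- [:: tt] & #|sigma| == 1%N]) ++
  [seq height G s sigma | sigma <- ord & #|sigma| == 1%N])) //.
  by rewrite perm_cat2r state_births_add.
by rewrite -catA /=; case: eqP.
Qed.

(** In every branch for a non-vertex exactly one pair is closed, and the height of the simplex is
    its death or, for a cycle, its birth. *)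
Lemma count_event_foldl h st ord :
  count (edge_event h) (filt_closed (foldl (add_simplex G s) st ord)) =
  (count (edge_event h) (filt_closed st) +
   count (fun sigma => (#|sigma| != 1%N) && (height G s sigma == h)) ord)%N.
Proof.
elim: ord st => [|sigma ord IH] st /=; first by rewrite addn0.
rewrite IH addnA; congr addn; case: st => cs cl; rewrite /add_simplex /=.
case: eqP => _ /=; first by rewrite addn0.
by case: [seq _ <- _ | _] => [|old [|young [|? ?]]] /=;
  rewrite -cats1 count_cat /= /edge_event /= addn0.
Qed.

Lemma size_foldl st ord :
  (size (filt_comps (foldl (add_simplex G s) st ord)) <= size (filt_comps st) + size ord)%N
  /\ (size (filt_closed (foldl (add_simplex G s) st ord))
      <= size (filt_closed st) + size ord)%N.
Proof.
elim: ord st => [|sigma ord IH] st /=; first by rewrite !addn0.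
have [l1 l2] := IH (add_simplex G s st sigma).
suff [l3 l4] : (size (filt_comps (add_simplex G s st sigma)) <= (size (filt_comps st)).+1)%N
  /\ (size (filt_closed (add_simplex G s st sigma)) <= (size (filt_closed st)).+1)%N by lia.
case: st {l1 l2} => cs cl; rewrite /add_simplex /=.
case: eqP => _ /=; first by rewrite size_rcons.
case: [seq _ <- _ | _] => [|old [|young [|? ?]]] /=; rewrite ?size_rcons //.
rewrite size_map; split=> //.
exact: leq_trans (size_subseq (rem_subseq _ _)) _.
Qed.

Lemma height_vertex (v : 'I_(nv G)) : height G s [set v] = dot (pos v) s.
Proof.
rewrite /height enum_set1 /= big_cons big_nil /= maxxx //.
Qed.

Lemma card1_simplices sigma :
  (sigma \in simplices G) && (#|sigma| == 1%N) = (sigma \in [set [set v] | v : 'I_(nv G)]).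
Proof.
rewrite inE; apply/idP/idP => [|/imsetP[v _ ->]].
  case/andP=> /orP[//|/edges_card2 ->]; by [].
by rewrite imset_f // cards1.
Qed.

Lemma vertex_simplices :
  perm_eq [seq sigma : {set 'I_(nv G)} <- enum (simplices G) | #|sigma| == 1%N]
          [seq [set v] | v <- enum 'I_(nv G)].
Proof.
apply: uniq_perm; first by rewrite filter_uniq // enum_uniq.
  by rewrite map_inj_uniq ?enum_uniq //; apply: set1_inj.
move=> sigma; rewrite mem_filter mem_enum andbC card1_simplices.
apply/imsetP/mapP => [[v _ ->]|[v _ ->]]; exists v => //; by rewrite mem_enum.
Qed.

(** Pairs of zero persistence are kept, so the birth of every vertex survives in the diagram, either
    in a closed pair or in a component that never dies. *)
Lemma births0_apd D : is_apd G s D ->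
  perm_eq (births0 D) [seq dot (pos v) s | v <- enum 'I_(nv G)].
Proof.
move=> [ord [po _ _] pD].
apply: (perm_trans (y := births0 (apd_of_order G s ord))).
  by apply: perm_map; apply: perm_filter.
rewrite /apd_of_order; set st := foldl _ _ _.
have -> : births0 (filt_closed st ++ [seq (c.1, +oo%E, 0%N) | c <- filt_comps st]) =
          births0 (filt_closed st) ++ [seq c.1 | c <- filt_comps st].
  rewrite /births0 filter_cat map_cat; congr cat.
  rewrite filter_map -map_comp /= -[X in _ = map _ X]filter_predT.
  exact: eq_map.
rewrite perm_catC; apply: (perm_trans (state_births_foldl _ _)) => /=.
rewrite (perm_trans
  (y := [seq height G s sigma | sigma <- [seq [set v] | v <- enum 'I_(nv G)]])) //.
  apply: perm_map; apply: perm_trans vertex_simplices.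
  exact: perm_filter.
rewrite -map_comp (eq_map (g := fun v => dot (pos v) s)) // => v /=.
exact: height_vertex.
Qed.

Lemma count_event_apd D h : is_apd G s D ->
  count (edge_event h) D = #|[set e in edges G | height G s e == h]|.
Proof.
move=> [ord [po _ _] pD].
rewrite (seq.permP pD) /apd_of_order count_cat count_event_foldl /= add0n.
(* Components that survive have death [+oo] and are not edge events. *)
rewrite [X in (_ + X)%N](_ : _ = 0%N) ?addn0; last first.
  by rewrite count_map; apply/eqP; rewrite -leqn0 leqNgt -has_count; apply/hasPn.
rewrite (seq.permP po) -size_filter cardE; apply: perm_size; apply: uniq_perm.
- by rewrite filter_uniq // enum_uniq.
- exact: enum_uniq.
move=> e; rewrite mem_filter !mem_enum !inE.
case: (boolP (e \in edges G)) => [ee|_].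
  by rewrite (edges_card2 ee) orbT andbT.
rewrite orbF /=; apply/negP => /andP[/andP[e1 _]].
rewrite -card1_simplices => /andP[_]; by rewrite (negbTE e1).
Qed.

Lemma card_edges : (#|edges G| <= nv G ^ 2)%N.
Proof.
have : (#|edges G| <= #|[set A : {set 'I_(nv G)} | #|A| == 2%N]|)%N.
  by apply: subset_leq_card; apply/subsetP => e /edges_card2 e2; rewrite inE e2.
rewrite card_draws card_ord => /leq_trans; apply.
rewrite bin2; case: (nv G) => [|n] //=; nia.
Qed.

(** Open components and closed pairs each number at most [#|simplices G|], and n + n^2 <= 2 n^2. *)
Lemma size_apd D : is_apd G s D -> (size D <= 4 * nv G ^ 2)%N.
Proof.
move=> [ord [po _ _] pD]; rewrite (perm_size pD) size_cat size_map.
have [] := size_foldl (FiltState [::] [::]) ord => /=.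
rewrite !add0n (perm_size po) -cardE => l1 l2.
have l3 : (#|simplices G| <= nv G + nv G ^ 2)%N.
  rewrite /simplices; apply: leq_trans (leq_card_setU _ _) _.
  by rewrite leq_add ?card_edges // (leq_trans (leq_imset_card _ _)) // card_ord.
have l4 (n : nat) : (n <= n ^ 2)%N by case: n => // n; nia.
have := l4 (nv G) => {}l4; apply: (@leq_trans (#|simplices G| + #|simplices G|)).
  exact: leq_add.
by move: l3 l4; set x := (nv G ^ 2)%N; lia.
Qed.

Lemma height_ge sigma v : v \in sigma -> dot (pos v) s <= height G s sigma.
Proof.
move=> vs; rewrite /height; set hs := [seq _ | _ <- _].
have : dot (pos v) s \in hs by apply: (map_f (fun v => dot (pos v) s)); rewrite mem_enum.
by move=> /seq_tnthP[i ->]; rewrite big_tnth; apply: le_bigmax.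
Qed.

Lemma height_attained sigma v : v \in sigma ->
  exists2 w, w \in sigma & height G s sigma = dot (pos w) s.
Proof.
move=> vs; rewrite /height; set hs := [seq _ | _ <- _].
suff : \big[Num.max/head 0 hs]_(h <- hs) h \in hs.
  by case/mapP => w; rewrite mem_enum => ws ->; exists w.
have : hs != [::].
  rewrite -size_eq0 size_map -cardE cards_eq0; apply/set0Pn; by exists v.
case: hs => // h hs _ /=.
rewrite big_seq; elim/big_ind: _ => [|x y|]; first by rewrite mem_head.
  by rewrite maxEle; case: ifP.
by [].
Qed.

End Diagrams.

(** * Query directions, decoding of heights, and the edge test *)

Section Directions.
Variable R : realType.
Implicit Types (t eps S : R) (d : nat).

Definition crd d (p : 'rV[R]_d) (k : nat) : R :=
  if insub k is Some j then p 0 j else 0.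

Lemma crdE d (p : 'rV[R]_d) (j : 'I_d) : crd p j = p 0 j.
Proof. by rewrite /crd valK. Qed.

Definition edir d (k : nat) : 'rV[R]_d := \row_j (j == k :> nat)%:R.

Definition sdir_norm eps d : R := Num.sqrt (\sum_(j < d) eps ^+ j * eps ^+ j).

Definition sdir d eps : 'rV[R]_d := \row_j (eps ^+ j / sdir_norm eps d).

Definition dir2_norm t : R := Num.sqrt (1 + t * t).

Definition dir2 d t : 'rV[R]_d :=
  \row_j (if j == 0%N :> nat then 1 / dir2_norm t
          else if j == 1%N :> nat then t / dir2_norm t else 0).

Lemma dot_edir d (p : 'rV[R]_d) (j : 'I_d) : dot p (edir d j) = p 0 j.
Proof.
rewrite /dot (bigD1 j) //= mxE eqxx mulr1 big1 ?addr0 // => i ij.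
have -> : edir d j 0 i = 0 by rewrite mxE (_ : (i == j :> nat) = false) //; apply/negbTE.
by rewrite mulr0.
Qed.

Lemma sphere_edir d (j : 'I_d) : sphere (edir d j).
Proof. by rewrite /sphere dot_edir mxE eqxx. Qed.

Lemma sdir_norm_gt0 eps d : (0 < d)%N -> 0 < sdir_norm eps d.
Proof.
case: d => // d _; rewrite sqrtr_gt0 big_ord_recl /= mulr1.
apply: ltr_pwDl => //; apply: sumr_ge0 => i _; exact: sqr_ge0.
Qed.

Lemma dot_sdir d (p : 'rV[R]_d) eps :
  dot p (sdir d eps) = (\sum_(j < d) eps ^+ j * p 0 j) / sdir_norm eps d.
Proof.
rewrite /dot mulr_suml; apply: eq_bigr => j _; rewrite mxE; ring.
Qed.

Lemma sphere_sdir d eps : (0 < d)%N -> sphere (sdir d eps).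
Proof.
move=> d0; rewrite /sphere dot_sdir; have N0 := sdir_norm_gt0 eps d0.
rewrite (eq_bigr (fun j : 'I_d => (eps ^+ j * eps ^+ j) / sdir_norm eps d)); last first.
  by move=> j _; rewrite mxE mulrA.
rewrite -mulr_suml -mulrA -invfM -expr2 sqr_sqrtr ?divff //.
  by rewrite gt_eqF // -sqrtr_gt0.
by apply: sumr_ge0 => i _; apply: sqr_ge0.
Qed.

Lemma dir2_norm_gt0 t : 0 < dir2_norm t.
Proof. by rewrite sqrtr_gt0; nra. Qed.

Lemma dot_dir2 d (o0 o1 : 'I_d) (p : 'rV[R]_d) t :
  o0 = 0%N :> nat -> o1 = 1%N :> nat ->
  dot p (dir2 d t) = (p 0 o0 + t * p 0 o1) / dir2_norm t.
Proof.
move=> e0 e1; have n10 : o1 != o0 by apply/eqP => /(congr1 val) /=; rewrite e0 e1.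
rewrite /dot (bigD1 o0) //= (bigD1 o1) //= !mxE e0 e1 /= big1 => [|i /andP[i0 i1]].
  by rewrite addr0; ring.
have h0 : (i == 0%N :> nat) = false by rewrite -e0; apply/negbTE.
have h1 : (i == 1%N :> nat) = false by rewrite -e1; apply/negbTE.
by rewrite mxE h0 h1 mulr0.
Qed.

Lemma sphere_dir2 d t : (1 < d)%N -> sphere (dir2 d t).
Proof.
move=> d1; rewrite /sphere.
rewrite (@dot_dir2 d (Ordinal (ltnW d1)) (Ordinal d1)) // !mxE /=.
have := dir2_norm_gt0 t; have : dir2_norm t ^+ 2 = 1 + t * t.
  by rewrite sqr_sqrtr //; nra.
move: (dir2_norm t) => N NE N0.
have Nn : N != 0 by rewrite gt_eqF.
transitivity ((1 + t * t) / N ^+ 2); first by field; exact: Nn.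
by rewrite -NE divff // expf_neq0.
Qed.

Lemma dir2_ratio d t (o0 o1 : 'I_d) : o0 = 0%N :> nat -> o1 = 1%N :> nat ->
  dir2 d t 0 o1 / dir2 d t 0 o0 = t.
Proof.
move=> e0 e1; rewrite !mxE e0 e1 /=; have := dir2_norm_gt0 t => N0.
by field; rewrite gt_eqF.
Qed.

Lemma dir2_inj d : (1 < d)%N -> injective (dir2 d).
Proof.
move=> d1 t t' e.
rewrite -(@dir2_ratio d t (Ordinal (ltnW d1)) (Ordinal d1)) // e.
by rewrite (@dir2_ratio d t').
Qed.

(** The first two coordinates of [dir2 d t] are both nonzero, whereas an axis has at most one
    nonzero coordinate. *)
Lemma dir2_neq_edir d t k : (1 < d)%N -> t != 0 -> dir2 d t != edir d k.
Proof.
move=> d1 t0; apply/eqP => e; have N0 := dir2_norm_gt0 t.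
have e0 := congr1 (fun v : 'rV_d => v 0 (Ordinal (ltnW d1))) e.
have e1 := congr1 (fun v : 'rV_d => v 0 (Ordinal d1)) e.
move: e0 e1; rewrite !mxE /= => e0 e1.
have : t / dir2_norm t != 0 by rewrite mulf_neq0 // invr_eq0 gt_eqF.
have : 1 / dir2_norm t != 0 by rewrite mulf_neq0 ?oner_eq0 // invr_eq0 gt_eqF.
by rewrite e0 e1; case: k {e e0 e1} => [|k]; rewrite /= ?eqxx //.
Qed.

(** The quotient of the second by the first coordinate is t on one side and eps on the other. *)
Lemma dir2_neq_sdir d t eps : (1 < d)%N -> t != eps -> dir2 d t != sdir d eps.
Proof.
move=> d1 t0; apply/eqP => e; have N0 := sdir_norm_gt0 eps (ltnW d1).
move/eqP: t0; apply; rewrite -(@dir2_ratio d t (Ordinal (ltnW d1)) (Ordinal d1)) // e !mxE /=.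
by rewrite expr0 expr1; field; rewrite gt_eqF.
Qed.

Lemma sdir_neq_edir d eps k : (1 < d)%N -> eps != 0 -> sdir d eps != edir d k.
Proof.
move=> d1 t0; apply/eqP => e; have N0 := sdir_norm_gt0 eps (ltnW d1).
have e0 := congr1 (fun v : 'rV_d => v 0 (Ordinal (ltnW d1))) e.
have e1 := congr1 (fun v : 'rV_d => v 0 (Ordinal d1)) e.
move: e0 e1; rewrite !mxE /= => e0 e1.
have : eps ^+ 1 / sdir_norm eps d != 0 by rewrite mulf_neq0 // invr_eq0 gt_eqF.
have : eps ^+ 0 / sdir_norm eps d != 0 by rewrite mulf_neq0 ?oner_eq0 // invr_eq0 gt_eqF.
by rewrite e0 e1; case: k {e e0 e1} => [|k]; rewrite /= ?eqxx //.
Qed.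

Lemma edir_inj d i j : (i < d)%N -> edir d i = edir d j -> i = j.
Proof.
move=> id /(congr1 (fun v : 'rV_d => v 0 (Ordinal id))); rewrite !mxE /= eqxx.
by case: eqP => // _ /eqP; rewrite oner_eq0.
Qed.

Lemma uniq_queries d eps (ts : seq R) : (1 < d)%N -> eps != 0 ->
  uniq (0 :: eps :: ts) ->
  uniq (rcons [seq edir d j | j <- iota 0 d] (sdir d eps) ++ [seq dir2 d t | t <- ts]).
Proof.
move=> d1 e0 /= /and3P[]; rewrite inE negb_or => /andP[_ n0] ne uts.
rewrite cat_uniq rcons_uniq map_inj_in_uniq ?iota_uniq ?andbT; last first.
  by move=> i j; rewrite mem_iota => /andP[_ id] _; apply: edir_inj.
rewrite map_inj_uniq ?uts ?andbT; last exact: dir2_inj.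
apply/andP; split.
  by apply/mapP => -[k _ /eqP]; rewrite (negbTE (sdir_neq_edir _ _ _)).
apply/hasPn => _ /mapP[t tt ->]; rewrite mem_rcons inE negb_or.
rewrite dir2_neq_sdir //=; last by apply: contra ne => /eqP <-.
apply/mapP => -[k _ /eqP]; apply/negP; apply: dir2_neq_edir => //.
by apply: contra n0 => /eqP <-.
Qed.

End Directions.

Section Decode.
Variable R : realType.
Implicit Types (p : nat -> R) (eps S : R).

(** What remains of the generic height after the coordinates before k have been subtracted and the
    rest divided by eps^k; n coordinates are left. *)
Fixpoint horner_tail p eps (n k : nat) : R :=
  if n is n'.+1 then p k + eps * horner_tail p eps n' k.+1 else 0.

Lemma horner_tailE p eps n k :
  horner_tail p eps n k = \sum_(j < n) eps ^+ j * p (k + j)%N.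
Proof.
elim: n k => [|n IH] k /=; first by rewrite big_ord0.
rewrite big_ord_recl /= expr0 mul1r addn0 IH mulr_sumr; congr (_ + _).
by apply: eq_bigr => j _; rewrite /bump /= exprS mulrA addSnnS.
Qed.

(** Geometric series of ratio at most 1/2: inductively S + eps * 2S <= 2S. *)
Lemma horner_tail_bound p eps S n k : 0 <= S -> 0 <= eps -> 2 * eps <= 1 ->
  (forall j, (k <= j < k + n)%N -> `|p j| <= S) ->
  `|horner_tail p eps n k| <= 2 * S.
Proof.
move=> S0 e0 e1; elim: n k => [|n IH] k pS /=; first by rewrite normr0; nra.
have pk : `|p k| <= S by apply: pS; lia.
have IH' : `|horner_tail p eps n k.+1| <= 2 * S by apply: IH => j jk; apply: pS; lia.
apply: le_trans (ler_normD _ _) _; rewrite normrM (ger0_norm e0).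
have := ler_wpM2l e0 IH'; have := ler_wpM2r S0 e1; lra.
Qed.

(** The contribution of r to y is at most 4S^2 / (2 + 4S^2) < 1 in absolute value, while a wrong
    entry contributes |2S(x - a)| >= 2, which leaves more than 1. *)
Lemma decode_test S (x r a : R) : 0 <= S -> `|r| <= 2 * S ->
  (x != a -> 1 <= S * `|x - a|) ->
  let y := 2 * S * (x + (2 + 4 * S * S)^-1 * r - a) in
  (-1 < y) && (y < 1) = (a == x).
Proof.
move=> S0 rS xa y; rewrite -ltr_norml.
have B0 : 0 < 2 + 4 * S * S by nra.
have small : `|2 * S * ((2 + 4 * S * S)^-1 * r)| < 1.
  rewrite mulrCA normrM gtr0_norm ?invr_gt0 // mulrC ltr_pdivrMr // mul1r.
  by rewrite normrM (ger0_norm (_ : 0 <= 2 * S)); nra.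
have [ax|xna] := eqVneq a x.
  rewrite ax in y *; have -> : y = 2 * S * ((2 + 4 * S * S)^-1 * r) by rewrite /y; ring.
  exact: small.
rewrite eq_sym in xna; have {xa} := xa xna => xa.
apply/negbTE; rewrite -leNgt.
have yE : y = 2 * S * (x - a) - (- (2 * S * ((2 + 4 * S * S)^-1 * r))) by rewrite /y; ring.
rewrite yE; apply: le_trans (lerB_dist _ _); rewrite normrN.
rewrite (_ : `|2 * S * (x - a)| = 2 * (S * `|x - a|)); last first.
  by rewrite normrM ger0_norm ?mulrA //; nra.
by move: small; set z := `|_|; lra.
Qed.

End Decode.

Section EdgeTest.
Variables (R : realType) (d : nat) (G : egraph R d) (o0 o1 : 'I_d).
Hypotheses (o0E : o0 = 0%N :> nat) (o1E : o1 = 1%N :> nat).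
Hypothesis gp : general_position G.
Implicit Types (u v k : 'I_(nv G)) (t : R).

(** The t for which p.1 + t p.2 = q.1 + t q.2. For p = q it is 0, since division by zero gives 0. *)
Definition slope (p q : R * R) : R := - (p.1 - q.1) / (p.2 - q.2).
Definition xy v : R * R := (pos v 0 o0, pos v 0 o1).

(** Height of k above v in direction (1, t) before normalization; for distinct vertices in general
    position, an affine function of t whose only zero is their slope. *)
Definition level v k t : R :=
  (xy k).1 - (xy v).1 + t * ((xy k).2 - (xy v).2).

Lemma dy_neq0 k v : k != v -> (xy k).2 - (xy v).2 != 0.
Proof. by move=> kv; rewrite subr_eq0; apply: gp.1. Qed.

Lemma level_slope v k t : k != v ->
  level v k t = ((xy k).2 - (xy v).2) * (t - slope (xy k) (xy v)).
Proof.
move=> /dy_neq0 n0; rewrite /level /slope; move: n0; rewrite subr_eq0.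
by move: (xy k) (xy v) => [a b] [a' b'] /= n0; field; rewrite subr_eq0.
Qed.

(** If both slopes were equal to t, the line x + t y = const through v would contain u and k as
    well. *)
Lemma slope_neq u v k : u != v -> k != v -> k != u ->
  slope (xy k) (xy v) != slope (xy u) (xy v).
Proof.
move=> uv kv ku; apply/eqP => e.
have := gp.2 o0 o1 k u v o0E o1E.
rewrite /= !inE negb_or ku kv uv => /(_ isT); apply.
set t := slope (xy u) (xy v) in e.
exists 1, t, ((xy v).1 + t * (xy v).2); split.
- by rewrite xpair_eqE oner_eq0.
- have := level_slope t kv; rewrite e subrr mulr0 /level /xy /=; lra.
- have := level_slope t uv; rewrite subrr mulr0 /level /xy /=; lra.
- by rewrite mul1r.
Qed.

Lemma dot_dir2_level v k t :
  dot (pos k) (dir2 d t) - dot (pos v) (dir2 d t) = level v k t / dir2_norm t.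
Proof. by rewrite !(dot_dir2 _ _ o0E o1E) /level /xy /=; ring. Qed.

(** The slope hypothesis makes the height of v unique among the vertices, so a maximum equal to it
    is attained at v itself. *)
Lemma height_eqE v t e :
  (forall k, k != v -> slope (xy k) (xy v) != t) -> e != set0 ->
  (height G (dir2 d t) e == dot (pos v) (dir2 d t)) =
  (v \in e) && [forall k in e, (k == v) || (level v k t < 0)].
Proof.
move=> sl /set0Pn[w we]; have N0 := dir2_norm_gt0 t.
have lvl k : (level v k t < 0) = (dot (pos k) (dir2 d t) < dot (pos v) (dir2 d t)).
  by rewrite -[RHS]subr_lt0 dot_dir2_level pmulr_llt0 ?invr_gt0.
have neq k : k != v -> dot (pos k) (dir2 d t) != dot (pos v) (dir2 d t).
  move=> kv; rewrite -subr_eq0 dot_dir2_level mulf_neq0 //; last first.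
    by rewrite invr_eq0 gt_eqF.
  by rewrite level_slope // mulf_neq0 ?dy_neq0 // subr_eq0 eq_sym sl.
apply/eqP/andP => [E|[ve /forall_inP H]].
  split.
    have [z ze] := height_attained (dir2 d t) we; rewrite E => dz.
    by have [<-//|/neq] := eqVneq z v; rewrite dz eqxx.
  apply/forall_inP => k ke; have [//|/neq kv /=] := eqVneq k v.
  by rewrite lvl lt_neqAle kv -E height_ge.
have [z ze zE] := height_attained (dir2 d t) we.
apply/eqP; rewrite eq_le height_ge // andbT zE.
by case/orP: (H z ze) => [/eqP -> //|]; rewrite lvl => /ltW.
Qed.

Lemma mul_gt0_sgn (a b : R) : 0 < a * b -> (a < 0) = (b < 0).
Proof.
move=> ab; apply/idP/idP => h.
  by rewrite -(nmulr_rgt0 _ h).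
by rewrite -(nmulr_lgt0 _ h).
Qed.

Lemma mul_lt0_sgn (a b : R) : a * b < 0 -> (a < 0) = ~~ (b < 0).
Proof.
move=> ab; rewrite -leNgt; apply/idP/idP => h.
  by move: ab; rewrite nmulr_rlt0 // => /ltW.
rewrite ltNge; apply/negP => a0; move: ab; rewrite ltNge => /negP; apply.
exact: mulr_ge0.
Qed.

(** For a vertex k with slope w relative to v, the product of its levels at t1 and t2 is y^2 ((s -
    w)^2 - dl^2), where y is the difference of second coordinates. It is negative for u and positive
    for all k other than u and v. Hence only u changes sides of v, and only the edge uv can gain or
    lose v as its top vertex. *)
Lemma edge_test u v (dl : R) D1 D2 :
  u != v -> dl != 0 ->
  (forall k, slope (xy k) (xy v) != slope (xy u) (xy v) ->
     `|dl| < `|slope (xy k) (xy v) - slope (xy u) (xy v)|) ->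
  let t1 := slope (xy u) (xy v) + dl in
  let t2 := slope (xy u) (xy v) - dl in
  is_apd G (dir2 d t1) D1 -> is_apd G (dir2 d t2) D2 ->
  (count (edge_event (dot (pos v) (dir2 d t1))) D1 !=
   count (edge_event (dot (pos v) (dir2 d t2))) D2) = ([set u; v] \in edges G).
Proof.
move=> uv dl0; set s := slope (xy u) (xy v) => dls t1 t2.
move=> /count_event_apd -> /count_event_apd ->.
have far k : k != v -> k != u ->
    0 < (s - slope (xy k) (xy v)) ^+ 2 - dl ^+ 2.
  move=> kv ku; have := dls k (slope_neq uv kv ku).
  rewrite distrC -ltr_sqr ?nnegrE // !real_normK ?num_real //; lra.
have dlp : 0 < dl ^+ 2 by rewrite exprn_even_gt0.
(* At t1 and t2 no other vertex is level with v, so [height_eqE] applies. *)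
have sl k t' : k != v -> t' = t1 \/ t' = t2 -> slope (xy k) (xy v) != t'.
  move=> kv t'E; apply/eqP => e; have [ku|ku] := eqVneq k u.
    by move: e t'E; rewrite ku -/s => <-; rewrite /t1 /t2; case=> e;
      move/eqP: dl0; apply; lra.
  have := far k kv ku; rewrite e => lt.
  by case: t'E lt => ->; rewrite /t1 /t2; lra.
have sgn k : k != v -> k != u -> (level v k t1 < 0) = (level v k t2 < 0).
  move=> kv ku; apply: mul_gt0_sgn; rewrite !level_slope //.
  have := far k kv ku; set y := (xy k).2 - _; set w := slope _ _ => fark.
  rewrite (_ : _ * _ = y ^+ 2 * ((s - w) ^+ 2 - dl ^+ 2)); last first.
    by rewrite /t1 /t2; ring.
  by rewrite mulr_gt0 // exprn_even_gt0 //= dy_neq0.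
have sgu : (level v u t1 < 0) = ~~ (level v u t2 < 0).
  apply: mul_lt0_sgn; rewrite !level_slope // -/s.
  set y := (xy u).2 - _; rewrite (_ : _ * _ = - (y ^+ 2 * dl ^+ 2)); last first.
    by rewrite /t1 /t2; ring.
  by rewrite oppr_lt0 mulr_gt0 // exprn_even_gt0 //= dy_neq0.
set E1 := [set e in _ | _]; set E2 := [set e in _ | _].
have e0 e : e \in edges G -> e != set0.
  by move=> /edges_card2; rewrite -cards_eq0 => ->.
have in1 e : e \in edges G -> (e \in E1) =
    (v \in e) && [forall k in e, (k == v) || (level v k t1 < 0)].
  by move=> ee; rewrite inE ee height_eqE ?e0 // => k kv; apply: sl => //; left.
have in2 e : e \in edges G -> (e \in E2) =
    (v \in e) && [forall k in e, (k == v) || (level v k t2 < 0)].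
  by move=> ee; rewrite inE ee height_eqE ?e0 // => k kv; apply: sl => //; right.
have same e : e \in edges G -> e != [set u; v] -> (e \in E1) = (e \in E2).
  move=> ee ne; rewrite in1 // in2 //; case: (boolP (v \in e)) => //= ve.
  have ue : u \notin e.
    apply: contra ne => ue; rewrite eq_sym eqEcard (edges_card2 ee) cards2 uv andbT.
    by apply/subsetP => x; rewrite !inE => /orP[]/eqP ->.
  apply: eq_forallb => k; case: (boolP (k \in e)) => //= ke.
  have [//|kv /=] := eqVneq k v; apply: sgn => //.
  by apply: contra ue => /eqP <-.
have sub1 e : e \in E1 -> e \in edges G by rewrite inE => /andP[].
have sub2 e : e \in E2 -> e \in edges G by rewrite inE => /andP[].
have [uve|uve] := boolP ([set u; v] \in edges G); last first.
  apply/negbTE; rewrite negbK; apply/eqP; congr #|pred_of_set _|; apply/setP => e.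
  have [ee|ee] := boolP (e \in edges G).
    by apply: same => //; apply: contra uve => /eqP <-.
  by rewrite (negbTE (contra (@sub1 e) ee)) (negbTE (contra (@sub2 e) ee)).
have diff : ([set u; v] \in E1) = ~~ ([set u; v] \in E2).
  rewrite in1 // in2 // !inE eqxx orbT /=.
  have F t : [forall k in [set u; v], (k == v) || (level v k t < 0)] = (level v u t < 0).
    apply/forall_inP/idP => [/(_ u)|h k].
      by rewrite !inE eqxx (negbTE uv) => /(_ isT).
    by rewrite !inE => /orP[]/eqP ->; rewrite ?h ?eqxx ?orbT.
  by rewrite !F.
(* When uv is an edge, it lies in exactly one of [E1] and [E2] while all other edges agree, so the
   cardinalities differ by one. *)
have card (A B : {set {set 'I_(nv G)}}) : [set u; v] \in A -> [set u; v] \notin B ->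
    (forall e, e != [set u; v] -> (e \in A) = (e \in B)) -> #|A| = #|B|.+1.
  move=> inA inB AB; rewrite (cardsD1 [set u; v] A) inA.
  rewrite (_ : A :\ [set u; v] = B) //; apply/setP => e; rewrite !inE.
  by have [->|ne] := eqVneq; [rewrite (negbTE inB) | rewrite /= AB].
have eqv e : e != [set u; v] -> (e \in E1) = (e \in E2).
  move=> ne; have [ee|ee] := boolP (e \in edges G); first exact: same.
  by rewrite (negbTE (contra (@sub1 e) ee)) (negbTE (contra (@sub2 e) ee)).
case: (boolP ([set u; v] \in E2)) diff => [in2' in1'|in2' in1'].
  rewrite (card E2 E1) ?in1' // ?neq_ltn ?ltnSn //.
  by move=> e ne; rewrite eqv.
by rewrite (card E1 E2) // neq_ltn ltnSn orbT.
Qed.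

End EdgeTest.

(** With b = 1/|a| one has b < 1 + b^2 <= D. A sum of such terms thus serves all a at once, with no
    minimum to compute. *)
Lemma small_step (R : realType) (D a : R) :
  1 + (1 / a) * (1 / a) <= D -> a != 0 -> 0 < 1 / D /\ 1 / D < `|a|.
Proof.
move=> aD a0; have D0 : 0 < D by nra.
split; first by rewrite divr_gt0.
have na : 0 < `|a| by rewrite normr_gt0.
rewrite ltr_pdivrMr //.
have : `|a| * (1 / `|a|) = 1 by field; rewrite gt_eqF.
have : (1 / `|a|) * (1 / `|a|) = (1 / a) * (1 / a).
  by rewrite !div1r -!expr2 !exprVn real_normK ?num_real.
by move: (1 / `|a|) => b; nra.
Qed.

(** * Querying the axes *)

(* Working arrays, besides those fixed by the input and output conventions:
   naturals (cell 0 of each): 10, 11, 13, 14 loop counters; 12 next free cell of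
   real array 4; 15, 17 start of a block of real array 4; 16 output pointer;
   19 the number n of vertices; 18 number of stored slopes; 20, 21, 22 pointers to
   vertices in real array 3; 23, 24 event counts; 25 number of edges found;
   reals: 4 the n births of each query to an axis and of the generic query; 5 the
   bound S; 6 eps; 9 its inverse; 7 a power of eps, then the height to decode;
   8 the norm of (1, eps, ...); 10 stored slopes; 11 the slope of a pair; 12 the
   perturbation; 13, 14, 15 slope, norm and vertex height of a query. *)
Definition collect_births : cmd :=
  For 11 1 (If (BEqN (NGet 3 (nvar 11)) (NLit 0))
              (RSet 4 (nvar 12) (RGet 1 (nvar 11)) ;; incr 12 ;; incr 19)%cmd
              Skip).

(* In the first round the truncated subtraction clears cell 0, which is then set
   to 1. *)
Definition query_axes : cmd :=
  (nset 12 (NLit 0) ;;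
   For 10 0
     (((RSet 0 (NSub (nvar 10) (NLit 1)) (RLit 0) ;; RSet 0 (nvar 10) (RLit 1)) ;;
      (Query ;; (nset 19 (NLit 0) ;; collect_births))))%cmd)%cmd.

(* As 1 / 0 = 0, the case of equal indices 13 and 14 needs no test. *)
Definition gap_term : rexp :=
  let x := RGet 4 (NAdd (nvar 15) (nvar 13)) in
  let y := RGet 4 (NAdd (nvar 15) (nvar 14)) in
  let g := RDiv (RLit 1) (RSub x y) in
  RAdd (RAdd (RLit 1) (RMul x x)) (RMul g g).

Definition sum_gaps : cmd :=
  ((rset 5 (RLit 0) ;; nset 15 (NLit 0)) ;;
   For 10 0
     (For 13 19 (For 14 19 (rset 5 (RAdd (rvar 5) gap_term))) ;;
      nset 15 (NAdd (nvar 15) (nvar 19))))%cmd.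

Section Phases.
Variables (R : realType) (d : nat) (G : egraph R d).
Variables (orc : 'rV[R]_d -> seq (dgm_point R)) (tau : 'rV[R]_d -> nat) (Tq : nat).
Local Notation n := (nv G).
Local Notation runs := (runs orc tau).
Implicit Types (m : memory R) (tr : seq 'rV[R]_d) (D : seq (dgm_point R)).

Definition holds_dgm D m : Prop :=
  [/\ nmem m 1%N 0%N = size D,
      forall k, (k < size D)%N -> nmem m 3%N k = (nth (0, +oo%E, 0%N) D k).2,
      forall k, (k < size D)%N ->
        nmem m 2%N k = ((nth (0, +oo%E, 0%N) D k).1.2 == +oo%E) :> nat,
      forall k, (k < size D)%N -> rmem m 1%N k = (nth (0, +oo%E, 0%N) D k).1.1 &
      forall k, (k < size D)%N -> rmem m 2%N k = fine (nth (0, +oo%E, 0%N) D k).1.2].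

Lemma load_dgmP D m : holds_dgm D (load_dgm D m).
Proof. by split=> //= k ->. Qed.

Lemma births0_rcons D p :
  births0 (rcons D p) = if p.2 == 0%N then rcons (births0 D) p.1.1 else births0 D.
Proof. by rewrite /births0 filter_rcons; case: eqP => // _; rewrite map_rcons. Qed.

Lemma runs_collect D m tr :
  holds_dgm D m -> (size D <= 4 * n ^ 2)%N -> nmem m 19%N 0%N = 0%N ->
  runs collect_births m tr (4 * n ^ 2 * 50 + 9)
    (fun m' tr' =>
       let p := nmem m 12%N 0%N in let b := births0 D in
       [/\ tr' = tr, nmem m' 19%N 0%N = size b, nmem m' 12%N 0%N = (p + size b)%N &
        forall i, rmem m' 4%N i =
          if (p <= i < p + size b)%N then nth 0 b (i - p) else rmem m 4%N i]).
Proof.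
move=> [D1 D3 _ R1 _] szD n0; set p := nmem m 12%N 0%N.
pose I k (m' : memory R) (tr' : seq 'rV[R]_d) :=
  let b := births0 (take k D) in
  [/\ tr' = tr, nmem m' 19%N 0%N = size b, nmem m' 12%N 0%N = (p + size b)%N &
   forall i, rmem m' 4%N i =
     if (p <= i < p + size b)%N then nth 0 b (i - p) else rmem m 4%N i].
apply: runs_weaken.
- rewrite /collect_births; eapply (runs_for (I := I) (nb := size D)) => //.
  + rewrite /I take0 /=; split=> // [|i]; first by rewrite addn0.
    by rewrite addn0 ltnNge andbN.
  + move=> k m' tr' kD kE fr [trE E19 E12 E4]; apply: runs_flat => //.
    rewrite /I (take_nth (0, +oo%E, 0%N)) // births0_rcons /=.
    rewrite /nvar /= kE (frame_nmem k fr) // D3 //.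
    case: eqP => _; last by split.
    rewrite /= /upd /= (frame_rmem k fr) // R1 // E12 E19 /= addn1 size_rcons.
    split=> // [|i]; first by rewrite ?addn1 addnS.
    rewrite E4 nth_rcons; set sz := size _.
    have -> : (i < p + sz.+1)%N = (i < p + sz)%N || (i == p + sz)%N by lia.
    case: (ltngtP i (p + sz)%N) => h /=; rewrite ?andbT ?andbF //=.
    * by case: (leqP p i) => //= pi; rewrite ltn_subLR // h.
    * by rewrite h leq_addr /= addKn ltnn eqxx.
- by rewrite /=; lia.
by move=> m' tr' _; rewrite /I take_size.
Qed.

(** A diagram gives the values of a coordinate only up to order, so each block is described by two
    inclusions, with no relation between the columns of different blocks. *)
Definition coord_table (f : nat -> R) : Prop := forall j : 'I_d,
  (forall v : 'I_n, exists2 c, (c < n)%N & f (j * n + c)%N = pos v 0 j) /\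
  (forall c, (c < n)%N -> exists v : 'I_n, f (j * n + c)%N = pos v 0 j).

Hypothesis d1 : (1 < d)%N.
Hypothesis orcP : apd_oracle G orc.
Hypothesis tauP : forall s, sphere s -> (tau s <= Tq)%N.

Lemma births0_orc s : sphere s ->
  perm_eq (births0 (orc s)) [seq dot (pos v) s | v : 'I_n].
Proof. by move=> /orcP /births0_apd. Qed.

Lemma size_births0 s : sphere s -> size (births0 (orc s)) = n.
Proof. by move=> /births0_orc /perm_size ->; rewrite size_map -cardE card_ord. Qed.

Lemma size_orc s : sphere s -> (size (orc s) <= 4 * n ^ 2)%N.
Proof. by move=> /orcP /size_apd. Qed.

Lemma coord_tableP f :
  (forall j c, (j < d)%N -> (c < n)%N ->
     f (j * n + c)%N = nth 0 (births0 (orc (edir R d j))) c) -> coord_table f.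
Proof.
move=> fE j; have pe := births0_orc (sphere_edir R j).
have sz := size_births0 (sphere_edir R j).
split=> [v|c cn].
  have : pos v 0 j \in births0 (orc (edir R d j)).
    by rewrite (perm_mem pe); apply/mapP; exists v; rewrite ?mem_enum // dot_edir.
  move=> /(nthP 0)[c]; rewrite sz => cn cE; exists c => //.
  by rewrite fE // ltn_ord.
have : f (j * n + c)%N \in births0 (orc (edir R d j)).
  by rewrite fE // mem_nth // sz.
by rewrite (perm_mem pe) => /mapP[v _ ->]; exists v; rewrite dot_edir.
Qed.

Lemma runs_query_axes m tr :
  nmem m 0%N 0%N = d -> (forall i, rmem m 0%N i = 0) ->
  runs query_axes m tr (d * (4 * n ^ 2 * 50 + Tq + 50) + 20)
    (fun m' tr' =>
       [/\ tr' = tr ++ [seq edir R d j | j <- iota 0 d],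
           nmem m' 19%N 0%N = n, nmem m' 12%N 0%N = (d * n)%N &
           coord_table (rmem m' 4%N)]).
Proof.
move=> dE R0.
(* After k rounds array 0 still holds the last axis, of index [k.-1], and for k = 0 it is zero; the
   birth count is known only once a query has been made. *)
pose I k (m' : memory R) (tr' : seq 'rV[R]_d) :=
  [/\ tr' = tr ++ [seq edir R d j | j <- iota 0 k],
      (0 < k -> nmem m' 19%N 0%N = n)%N, nmem m' 12%N 0%N = (k * n)%N,
      forall i, (i < d)%N -> rmem m' 0%N i = ((0 < k)%N && (i == k.-1))%:R &
      forall j c, (j < k)%N -> (c < n)%N ->
        rmem m' 4%N (j * n + c)%N = nth 0 (births0 (orc (edir R d j))) c].
apply: runs_weaken.
- rewrite /query_axes; eapply (runs_seq (Q1 := fun m' tr' => m' = setn m 12 0 /\ tr' = tr)).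
    exact: runs_flat.
  move=> _ _ _ [-> ->].
  eapply (runs_for (I := I) (nb := d)) => //.
  + split=> //=; first by rewrite cats0.
  + move=> k m1 tr1 kd kE fr1 [trE _ E12 E0 E4].
    apply: (runs_seq (Q1 := fun m2 tr2 => tr2 = tr1 /\
      forall i, (i < d)%N -> rmem m2 0%N i = (i == k)%:R)).
      apply: runs_flat => //=; split=> // i id.
      rewrite /upd /= kE; case: (eqVneq i k) => //= ik; rewrite E0 //.
      by case: k {kE E4 E12 trE} ik E0 kd => [|k] //= ik _ _; rewrite subn1 /=; case: eqP.
    move=> m2 tr2 fr2 [-> E02].
    have sk : sphere (edir R d k) by apply: (sphere_edir R (Ordinal kd)).
    apply: (runs_seq (Q1 := fun m3 tr3 => tr3 = rcons tr1 (edir R d k) /\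
       holds_dgm (orc (edir R d k)) m3)).
      apply: runs_query; [|exact: sk|exact: tauP|by split=> //; apply: load_dgmP].
      by apply/rowP => i; rewrite !mxE E02.
    move=> m3 tr3 fr3 [-> H3].
    apply: (runs_seq (Q1 := fun m4 tr4 => m4 = setn m3 19 0 /\ tr4 = rcons tr1 (edir R d k))).
      exact: runs_flat.
    move=> m4 tr4 _ [-> ->].
    apply: runs_weaken.
    * apply: (@runs_collect (orc (edir R d k))) => //; exact: size_orc.
    * exact: leqnn.
    move=> m5 tr5 fr5 [-> E19 E12' E4'].
    have p12 : nmem m3 12%N 0%N = (k * n)%N.
      by rewrite (frame_nmem _ fr3) // (frame_nmem _ fr2).
    rewrite /= /upd /= p12 size_births0 // in E12' E4' *.
    have trE' : rcons tr1 (edir R d k) = tr ++ [seq edir R d j | j <- iota 0 k.+1].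
      by rewrite -[k.+1]addn1 iotaD map_cat catA -trE cats1.
    split; first exact: trE'; rewrite /= /upd /=.
    * by rewrite E19 size_births0.
    * by rewrite E12' mulSn addnC.
    * move=> i id; rewrite (frame_rmem _ fr5) // /= (frame_rmem _ fr3) //.
      by rewrite E02.
    move=> j c jk cn; rewrite E4'; move: jk; rewrite ltnS leq_eqVlt.
    case/orP=> [/eqP -> |jk]; first by rewrite leq_addr ltn_add2l cn addKn.
    have lt : (j * n + c < k * n)%N.
      by apply: (@leq_trans (j.+1 * n)); rewrite ?leq_mul2r ?jk ?orbT // mulSn; lia.
    rewrite leqNgt lt /= (frame_rmem _ fr3) // (frame_rmem _ fr2) //.
    exact: E4.
- rewrite /=; lia.
move=> m' tr' _ [-> E19 E12 _ E4]; split=> //; first by apply: E19; lia.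
exact: coord_tableP.
Qed.

End Phases.

(** * Recovering the vertices *)

Definition query_generic : cmd :=
  ((rset 9 (RAdd (RLit 2) (RMul (RMul (RLit 4) (rvar 5)) (rvar 5))) ;;
    rset 6 (RDiv (RLit 1) (rvar 9)) ;; rset 7 (RLit 1) ;; rset 8 (RLit 0)) ;;
   (For 10 0 (RSet 0 (nvar 10) (rvar 7) ;;
              rset 8 (RAdd (rvar 8) (RMul (rvar 7) (rvar 7))) ;;
              rset 7 (RMul (rvar 7) (rvar 6))) ;;
   (rset 8 (RSqrt (rvar 8)) ;;
   (For 10 0 (RSet 0 (nvar 10) (RDiv (RGet 0 (nvar 10)) (rvar 8))) ;;
   (Query ;; (nset 19 (NLit 0) ;; collect_births))))))%cmd.

(** The comparison is that of [decode_test]. *)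
Definition match_coord : cmd :=
  let x := RGet 4 (NAdd (nvar 17) (nvar 14)) in
  let y := RMul (RMul (RLit 2) (rvar 5)) (RSub (rvar 7) x) in
  If (BAnd (BLtR (RSub (RLit 0) (RLit 1)) y) (BLtR y (RLit 1)))
    (RSet 3 (nvar 16) x) Skip.

(** Multiplying by the norm in cell 8 turns a height into a polynomial in eps; subtracting the
    coordinate just found and multiplying by 1/eps exposes the next one. *)
Definition decode_coords : cmd :=
  (nset 16 (NLit 0) ;;
   For 13 19
     ((rset 7 (RMul (RGet 4 (NAdd (nvar 15) (nvar 13))) (rvar 8)) ;;
       nset 17 (NLit 0)) ;;
      For 10 0
        (For 14 19 match_coord ;;
         (rset 7 (RMul (RSub (rvar 7) (RGet 3 (nvar 16))) (rvar 9)) ;;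
          incr 16 ;; nset 17 (NAdd (nvar 17) (nvar 19))))))%cmd.

Section Phases2.
Variables (R : realType) (d : nat) (G : egraph R d).
Variables (orc : 'rV[R]_d -> seq (dgm_point R)) (tau : 'rV[R]_d -> nat) (Tq : nat).
Hypothesis d1 : (1 < d)%N.
Hypothesis orcP : apd_oracle G orc.
Hypothesis tauP : forall s, sphere s -> (tau s <= Tq)%N.
Local Notation n := (nv G).
Local Notation runs := (runs orc tau).
Implicit Types (m : memory R) (tr : seq 'rV[R]_d) (f : nat -> R).

(** Since |z| <= 1 + z^2, this dominates both |x| and 1/|x - y| for two entries x, y of block j. *)
Definition gap_value f (j a b : nat) : R :=
  let x := f (j * n + a)%N in
  1 + x * x + 1 / (x - f (j * n + b)%N) * (1 / (x - f (j * n + b)%N)).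

(* The triples (j, a', b') lexicographically below (k, a, b) are done. *)
Definition gap_bound f (k a b : nat) (S : R) : Prop :=
  0 <= S /\ forall j a' b', (a' < n)%N -> (b' < n)%N ->
    (j < k)%N || (j == k) && ((a' < a)%N || (a' == a) && (b' < b)%N) ->
    gap_value f j a' b' <= S.

Lemma gap_value_ge0 f j a b : 0 <= gap_value f j a b.
Proof. by rewrite /gap_value; nra. Qed.

Lemma gap_bound_sub f k a b k' a' b' S :
  (forall j x y, (x < n)%N -> (y < n)%N ->
    (j < k')%N || (j == k') && ((x < a')%N || (x == a') && (y < b')%N) ->
    (j < k)%N || (j == k) && ((x < a)%N || (x == a) && (y < b)%N)) ->
  gap_bound f k a b S -> gap_bound f k' a' b' S.
Proof. by move=> sub [S0 H]; split=> // j x y xn yn /sub h; apply: H => //; apply: h. Qed.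

(** All terms are nonnegative, so their sum dominates each of them. The block pointer ends at d n,
    where the births of the generic query will be stored. *)
Lemma runs_sum_gaps m tr :
  nmem m 0%N 0%N = d -> nmem m 19%N 0%N = n ->
  runs sum_gaps m tr (d * (n * (n * 70 + 70) + 70) + 70)
    (fun m' tr' => [/\ tr' = tr, nmem m' 15%N 0%N = (d * n)%N &
       gap_bound (rmem m 4%N) d 0 0 (rmem m' 5%N 0%N)]).
Proof.
move=> dE nE; set f := rmem m 4%N.
pose I k (m' : memory R) (tr' : seq 'rV[R]_d) :=
  [/\ tr' = tr, nmem m' 15%N 0%N = (k * n)%N & gap_bound f k 0 0 (rmem m' 5%N 0%N)].
apply: runs_weaken.
- rewrite /sum_gaps; eapply (runs_seq (Q1 := fun m' tr' =>
    [/\ tr' = tr, nmem m' 15%N 0%N = 0%N & rmem m' 5%N 0%N = 0])).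
    exact: runs_flat.
  move=> m0 tr0 fr0 [-> E15 E5].
  eapply (runs_for (I := I) (nb := d)) => //.
  + by rewrite (frame_nmem _ fr0).
  + by split=> //=; split; rewrite /= E5 // => j a b an bn; lia.
  move=> k m1 tr1 kd kE fr1 [-> E151 B1].
  eapply (runs_seq (Q1 := fun m' tr' => tr' = tr /\
     gap_bound f k n 0 (rmem m' 5%N 0%N))).
    eapply runs_weaken.
    * eapply (runs_for (nb := n) (I := fun a m' tr' => tr' = tr /\
         gap_bound f k a 0 (rmem m' 5%N 0%N))) => //.
      - by rewrite (frame_nmem _ fr1) // (frame_nmem _ fr0).
      move=> a m2 tr2 an aE fr2 [-> B2].
      eapply runs_weaken.
      + eapply (runs_for (nb := n) (I := fun b m' tr' => tr' = tr /\
           gap_bound f k a b (rmem m' 5%N 0%N))) => //.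
        - by rewrite (frame_nmem _ fr2) // (frame_nmem _ fr1) // (frame_nmem _ fr0).
        move=> b m3 tr3 bn bE fr3 [-> [S0 B3]]; apply: runs_flat => //; split=> //.
        rewrite /= /upd /= bE.
        rewrite !(frame_nmem _ fr3) // aE !(frame_nmem _ fr2) // E151.
        rewrite !(frame_rmem (a := 4) _ fr3) // !(frame_rmem (a := 4) _ fr2) //.
        rewrite !(frame_rmem (a := 4) _ fr1) //.
        rewrite !(frame_rmem (a := 4) _ fr0) // -/f -/(gap_value f k a b).
        have g0 := gap_value_ge0 f k a b.
        split; first exact: addr_ge0.
        move=> j a' b' a'n b'n h.
        have [[-> [-> ->]]|ne] : (j = k /\ a' = a /\ b' = b) \/
          (j < k)%N || (j == k) && ((a' < a)%N || (a' == a) && (b' < b)%N) by lia.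
          by rewrite lerDr.
        by apply: le_trans (B3 _ _ _ _ _ ne) _ => //; rewrite lerDl.
      + exact: leqnn.
      move=> m3 tr3 fr3 [-> B3]; split=> //=.
      by apply: gap_bound_sub B3 => j x y xn yn; lia.
    * exact: leqnn.
    by [].
  move=> m2 tr2 fr2 [-> B2]; apply: runs_flat => //; split=> //=.
    rewrite /upd /= !(frame_nmem _ fr2) // E151 (frame_nmem _ fr1) // (frame_nmem _ fr0) // nE.
    by rewrite mulSn addnC.
  by apply: gap_bound_sub B2 => j x y xn yn; lia.
- rewrite /=; nia.
by [].
Qed.

Lemma runs_query_generic m tr (S := rmem m 5%N 0%N) (eps := (2 + 4 * S * S)^-1) :
  nmem m 0%N 0%N = d -> nmem m 12%N 0%N = (d * n)%N ->
  runs query_generic m tr (d * 100 + 4 * n ^ 2 * 50 + Tq + 200)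
    (fun m' tr' =>
       [/\ tr' = rcons tr (sdir d eps), nmem m' 19%N 0%N = n,
           [/\ rmem m' 6%N 0%N = eps, rmem m' 8%N 0%N = sdir_norm eps d &
               rmem m' 9%N 0%N = 2 + 4 * S * S],
           forall c, (c < n)%N ->
             rmem m' 4%N (d * n + c)%N = nth 0 (births0 (orc (sdir d eps))) c &
           forall i, (i < d * n)%N -> rmem m' 4%N i = rmem m 4%N i]).
Proof.
move=> dE pE; have ss : sphere (sdir d eps) by apply: sphere_sdir; lia.
pose I1 k (m' : memory R) (tr' : seq 'rV[R]_d) :=
  [/\ tr' = tr, rmem m' 7%N 0%N = eps ^+ k,
      rmem m' 8%N 0%N = \sum_(j < k) eps ^+ j * eps ^+ j &
      forall i, (i < k)%N -> rmem m' 0%N i = eps ^+ i].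
pose I2 k (m' : memory R) (tr' : seq 'rV[R]_d) :=
  tr' = tr /\ forall i, (i < d)%N ->
    rmem m' 0%N i = if (i < k)%N then eps ^+ i / sdir_norm eps d else eps ^+ i.
apply: runs_budget.
- rewrite /query_generic; eapply (runs_seq (Q1 := fun m' tr' =>
    [/\ tr' = tr, rmem m' 9%N 0%N = 2 + 4 * S * S, rmem m' 6%N 0%N = eps,
        rmem m' 7%N 0%N = 1 & rmem m' 8%N 0%N = 0])).
    by apply: runs_flat => //=; split; rewrite // /upd /= div1r.
  move=> m0 tr0 fr0 [-> E9 E6 E7 E8].
  eapply runs_seq.
    eapply (runs_for (I := I1) (nb := d)) => //.
    + by rewrite (frame_nmem _ fr0).
    + by split; rewrite //= ?big_ord0 ?expr0.
    move=> k m1 tr1 kd kE fr1 [-> E71 E81 E01]; apply: runs_flat => //.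
    split; rewrite //= /upd /=.
    * by rewrite E71 (frame_rmem _ fr1) // E6 exprSr.
    * by rewrite E81 E71 big_ord_recr.
    move=> i; rewrite kE ltnS leq_eqVlt; case: eqP => [-> _|_ /= ik] //=.
    exact: E01.
  move=> m1 tr1 fr1 [-> _ E81 E01].
  eapply (runs_seq (Q1 := fun m' tr' => tr' = tr /\ rmem m' 8%N 0%N = sdir_norm eps d)).
    by apply: runs_flat => //=; split; rewrite // /upd /= E81.
  move=> m2 tr2 fr2 [-> E82].
  eapply runs_seq.
    eapply (runs_for (I := I2) (nb := d)) => //.
    + by rewrite (frame_nmem _ fr2) // (frame_nmem _ fr1) // (frame_nmem _ fr0).
    + by split=> //= i id; rewrite (frame_rmem _ fr2) // E01.
    move=> k m3 tr3 kd kE fr3 [-> E03]; apply: runs_flat => //; split=> //= i id.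
    rewrite /upd /= kE (frame_rmem (a := 8) _ fr3) // E82.
    case: (ltngtP i k) => ik.
    * by rewrite E03 // ik ltnS ltnW.
    * by rewrite E03 // ![(i < _)%N]ltnNge ik (ltnW ik).
    * by rewrite ik E03 // ltnn ltnSn.
  move=> m3 tr3 fr3 [-> E03].
  eapply (runs_seq (Q1 := fun m' tr' => tr' = rcons tr (sdir d eps) /\
     holds_dgm (orc (sdir d eps)) m')).
    apply: runs_query; [|exact: ss|exact: tauP|by split=> //; apply: load_dgmP].
    by apply/rowP => i; rewrite !mxE E03 ?ltn_ord.
  move=> m4 tr4 fr4 [-> H4].
  eapply (runs_seq (Q1 := fun m' tr' => m' = setn m4 19 0 /\ tr' = rcons tr (sdir d eps))).
    exact: runs_flat.
  move=> m5 tr5 _ [-> ->].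
  eapply runs_weaken.
  * eapply (@runs_collect _ _ G _ _ (orc (sdir d eps))) => //; exact: size_orc.
  * exact: leqnn.
  move=> m6 tr6 fr6 [-> E19 _ E4].
  have p12 : nmem m4 12%N 0%N = (d * n)%N.
    by rewrite (frame_nmem _ fr4) // (frame_nmem _ fr3) // (frame_nmem _ fr2) //
      (frame_nmem _ fr1) // (frame_nmem _ fr0).
  rewrite /= /upd /= p12 (size_births0 orcP) // in E19 E4.
  split=> //.
  * split.
    - by rewrite (frame_rmem _ fr6) //= (frame_rmem _ fr4) // (frame_rmem _ fr3) //
        (frame_rmem _ fr2) // (frame_rmem _ fr1) // E6.
    - by rewrite (frame_rmem _ fr6) //= (frame_rmem _ fr4) // (frame_rmem _ fr3) // E82.
    - by rewrite (frame_rmem _ fr6) //= (frame_rmem _ fr4) // (frame_rmem _ fr3) //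
        (frame_rmem _ fr2) // (frame_rmem _ fr1) // E9.
  * by move=> c cn; rewrite E4 leq_addr ltn_add2l cn addKn.
  move=> i ilt; rewrite E4 leqNgt ilt /=.
  by rewrite (frame_rmem _ fr4) // (frame_rmem _ fr3) // (frame_rmem _ fr2) //
    (frame_rmem _ fr1) // (frame_rmem _ fr0).
by rewrite /=; nia.
Qed.

(** Natural indices allow an output cell to be addressed by its quotient and remainder modulo d. *)
Definition out_coord (phi : 'S_n) (i j : nat) : R :=
  if insub i is Some i' then crd (pos (phi i')) j else 0.

Lemma out_coordE (phi : 'S_n) (i : 'I_n) (j : 'I_d) :
  out_coord phi i j = pos (phi i) 0 j.
Proof. by rewrite /out_coord valK crdE. Qed.

(** The order in which the diagram happens to list its births becomes, for the generic direction,
    the order of the output vertices. *)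
Lemma births0_perm s : sphere s -> exists phi : 'S_n, forall i : 'I_n,
  nth 0 (births0 (orc s)) i = dot (pos (phi i)) s.
Proof.
move=> ss; have := births0_orc orcP ss.
have -> : [seq dot (pos v) s | v : 'I_n] = [tuple dot (pos v) s | v < n] by [].
case/tuple_permP => phi ->; exists phi => i.
by rewrite -tnth_nth !tnth_mktuple.
Qed.

Lemma gap_sep f k a b S : gap_bound f k 0 0 S -> (a < n)%N -> (b < n)%N ->
  forall j, (j < k)%N ->
  `|f (j * n + a)%N| <= S /\
  (f (j * n + a)%N != f (j * n + b)%N ->
     1 <= S * `|f (j * n + a)%N - f (j * n + b)%N|).
Proof.
move=> [S0 H] an bn j jk; have := H j a b an bn; rewrite jk => /(_ isT).
rewrite /gap_value; set x := f _; set y := f _ => le; split.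
  rewrite ler_norml; apply/andP; split; nra.
rewrite -subr_eq0 => xy; have le' : 1 + 1 / (x - y) * (1 / (x - y)) <= S by nra.
have [S1 S2] := small_step le' xy.
have Spos : 0 < S by nra.
by move: S2; rewrite ltr_pdivrMr // mulrC => /ltW.
Qed.

Lemma runs_decode m tr (S := rmem m 5%N 0%N) (eps := (2 + 4 * S * S)^-1) :
  nmem m 0%N 0%N = d -> nmem m 19%N 0%N = n -> nmem m 15%N 0%N = (d * n)%N ->
  coord_table G (rmem m 4%N) -> gap_bound (rmem m 4%N) d 0 0 S ->
  rmem m 8%N 0%N = sdir_norm eps d -> rmem m 9%N 0%N = 2 + 4 * S * S ->
  (forall c, (c < n)%N ->
     rmem m 4%N (d * n + c)%N = nth 0 (births0 (orc (sdir d eps))) c) ->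
  runs decode_coords m tr (n * (d * (n * 70 + 70) + 70) + 70)
    (fun m' tr' => tr' = tr /\ exists phi : 'S_n, forall (i : 'I_n) (j : 'I_d),
       rmem m' 3%N (i * d + j)%N = pos (phi i) 0 j).
Proof.
move=> dE nE E15 tab bnd E8 E9 E4; set f := rmem m 4%N in tab bnd.
have d0 : (0 < d)%N by apply: ltnW.
have [phi phiE] := births0_perm (sphere_sdir eps d0).
pose Y q := out_coord phi (q %/ d) (q %% d).
have YE (i : 'I_n) (j : 'I_d) : Y (i * d + j)%N = pos (phi i) 0 j.
  by rewrite /Y divnMDl // divn_small // addn0 modnMDl modn_small // out_coordE.
pose I q (m' : memory R) (tr' : seq 'rV[R]_d) :=
  [/\ tr' = tr, nmem m' 16%N 0%N = q & forall i, (i < q)%N -> rmem m' 3%N i = Y i].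
have S0 : 0 <= S by case: bnd.
have B0 : 0 < 2 + 4 * S * S by nra.
have Beps : (2 + 4 * S * S) * eps = 1 by rewrite divff // gt_eqF.
have eps0 : 0 <= eps by rewrite invr_ge0 ltW.
have eps2 : 2 * eps <= 1 by nra.
apply: runs_weaken.
- rewrite /decode_coords; eapply (runs_seq (Q1 := I 0%N)).
    by apply: runs_flat.
  move=> m0 tr0 fr0 I0.
  eapply (runs_for (nb := n) (I := fun c => I (c * d)%N)) => //.
  + by rewrite (frame_nmem _ fr0).
  move=> c m1 tr1 cn cE fr1 I1; have {I1} [-> E16 E3] := I1.
  pose c' := Ordinal cn; pose p := out_coord phi c.
  have pE (j : 'I_d) : p j = pos (phi c') 0 j by rewrite -(out_coordE phi c' j).
  have YcE k : (k < d)%N -> Y (c * d + k)%N = p k.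
    by move=> kd; rewrite (YE c' (Ordinal kd)) -pE.
  have pS j : (j < d)%N -> `|p j| <= S.
    move=> jd; have [/(_ (phi c')) [a an aE] _] := tab (Ordinal jd).
    by rewrite (pE (Ordinal jd)) -aE; have [] := gap_sep bnd an an jd.
  eapply (runs_seq (Q1 := fun m' tr' => [/\ I (c * d)%N m' tr',
     nmem m' 17%N 0%N = 0%N & rmem m' 7%N 0%N = horner_tail p eps d 0])).
    apply: runs_flat => //=; split; rewrite /= /upd //=.
    rewrite cE (frame_nmem _ fr1) // (frame_nmem _ fr0) // E15.
    rewrite !(frame_rmem _ fr1) // !(frame_rmem _ fr0) // E8 E4 //.
    rewrite (phiE c') dot_sdir divfK ?gt_eqF ?sdir_norm_gt0 // horner_tailE.
    by apply: eq_bigr => j _; rewrite pE.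
  move=> m2 tr2 fr2 [I2 E172 E72].
  (* After k coordinates cell 7 of the reals holds the Horner tail from k on, and the block pointer
     is at table k. *)
  pose J k (m' : memory R) (tr' : seq 'rV[R]_d) := [/\ I (c * d + k)%N m' tr',
     nmem m' 17%N 0%N = (k * n)%N & rmem m' 7%N 0%N = horner_tail p eps (d - k) k].
  eapply runs_weaken.
  + eapply (runs_for (nb := d) (I := J)) => //.
    - by rewrite (frame_nmem _ fr2) // (frame_nmem _ fr1) // (frame_nmem _ fr0).
    - by rewrite /J addn0 subn0.
    move=> k m3 tr3 kd kE fr3 [[-> E163 E33] E173 E73].
    have tl : horner_tail p eps (d - k) k =
        p k + eps * horner_tail p eps (d - k.+1) k.+1 by rewrite -subnSK.
    (* Only entries equal to [p k] pass the test, so once a matching entry has been scanned the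
       output cell is right and stays so. *)
    pose K a (m' : memory R) (tr' : seq 'rV[R]_d) := [/\ tr' = tr,
      forall i, (i < c * d + k)%N -> rmem m' 3%N i = Y i &
      forall b, (b < a)%N -> f (k * n + b)%N = p k ->
        rmem m' 3%N (c * d + k)%N = p k].
    eapply (runs_seq (Q1 := K n)).
      eapply runs_weaken.
      * eapply (runs_for (nb := n) (I := K)) => //.
        - by rewrite (frame_nmem _ fr3) // (frame_nmem _ fr2) // (frame_nmem _ fr1) //
            (frame_nmem _ fr0).
        move=> a m4 tr4 an aE fr4 [-> E34 E34'].
        have tst : (-1 < 2 * S * (p k + eps * horner_tail p eps (d - k.+1) k.+1 -
                       f (k * n + a)%N)) &&
            (2 * S * (p k + eps * horner_tail p eps (d - k.+1) k.+1 -
                       f (k * n + a)%N) < 1) = (f (k * n + a)%N == p k).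
          apply: decode_test => //.
            by apply: horner_tail_bound => // j jk; apply: pS; lia.
          have [/(_ (phi c')) [b bn bE] _] := tab (Ordinal kd).
          by rewrite (pE (Ordinal kd)) -bE; case: (gap_sep bnd bn an kd) => _; exact.
        have E174 : nmem m4 17%N 0%N = (k * n)%N by rewrite (frame_nmem _ fr4).
        have E164 : nmem m4 16%N 0%N = (c * d + k)%N by rewrite (frame_nmem _ fr4).
        have E54 : rmem m4 5%N 0%N = S.
          by rewrite (frame_rmem _ fr4) // (frame_rmem _ fr3) // (frame_rmem _ fr2) //
            (frame_rmem _ fr1) // (frame_rmem _ fr0).
        have E44 i : rmem m4 4%N i = f i.
          by rewrite (frame_rmem _ fr4) // (frame_rmem _ fr3) // (frame_rmem _ fr2) //
            (frame_rmem _ fr1) // (frame_rmem _ fr0).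
        have E74 : rmem m4 7%N 0%N = horner_tail p eps (d - k) k.
          by rewrite (frame_rmem _ fr4).
        apply: runs_flat => //.
        rewrite /= aE E174 E164 E54 E44 E74 sub0r tl tst.
        case: eqP => [fE|fE] /=.
          split=> //= [i ik|b _ _]; first by rewrite /upd /= ltn_eqF // E34.
          by rewrite /upd /= eqxx.
        split=> // b.
        by rewrite ltnS leq_eqVlt => /orP[/eqP ->|]; [| exact: E34'].
      * exact: leqnn.
      by [].
    move=> m4 tr4 fr4 [-> E34 E34'].
    (* Table k contains [p k], so some entry has matched. *)
    have E3c : rmem m4 3%N (c * d + k)%N = p k.
      have [/(_ (phi c')) [b bn bE] _] := tab (Ordinal kd).
      by apply: (E34' b) => //; rewrite (pE (Ordinal kd)).
    apply: runs_flat => //; rewrite /J /= /upd /=.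
    have E164 : nmem m4 16%N 0%N = (c * d + k)%N by rewrite (frame_nmem _ fr4).
    split.
    * rewrite /I /= E164; split=> //; first by rewrite addn1 addnS.
      move=> i; rewrite addnS ltnS leq_eqVlt => /orP[/eqP ->|]; last exact: E34.
      by rewrite E3c YcE.
    * rewrite !(frame_nmem _ fr4) // E173 (frame_nmem _ fr3) // (frame_nmem _ fr2) //.
      by rewrite (frame_nmem _ fr1) // (frame_nmem _ fr0) // nE mulSn addnC.
    * rewrite E164 E3c (frame_rmem _ fr4) // E73 tl (frame_rmem _ fr4) //.
      rewrite (frame_rmem _ fr3) // (frame_rmem _ fr2) // (frame_rmem _ fr1) //.
      rewrite (frame_rmem _ fr0) // E9.
      by rewrite addrAC subrr add0r mulrC mulrA Beps mul1r.
  + exact: leqnn.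
  move=> m3 tr3 fr3 [[-> E16' E3'] _ _].
  have e : (c * d + d = c.+1 * d)%N by rewrite mulSn addnC.
  by rewrite /I -e; split.
- rewrite /=; nia.
move=> m' tr' _ [-> _ E3]; split=> //; exists phi => i j.
rewrite E3 ?YE //; apply: (@leq_trans (i.+1 * d)).
  by rewrite mulSn addnC ltn_add2r.
by rewrite leq_mul2r ltn_ord orbT.
Qed.

End Phases2.

(** * Recovering the edges *)

Definition count_events : cmd :=
  For 11 1
    (If (BEqN (NGet 3 (nvar 11)) (NLit 1))
       (If (BEqR (RGet 1 (nvar 11)) (rvar 15)) (incr 23) Skip)
       (If (BAnd (BEqN (NGet 3 (nvar 11)) (NLit 0))
              (BAnd (BEqN (NGet 2 (nvar 11)) (NLit 0))
                 (BEqR (RGet 2 (nvar 11)) (rvar 15)))) (incr 23) Skip)).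

Definition snd_coord (a : nat) : rexp := RGet 3 (NAdd (nvar a) (NLit 1)).

(** Only the first two cells of the direction are written, the others being 0 already. The vertex
    height is computed exactly, so it can be compared with births and deaths by equality. The slope
    is stored so that later perturbations avoid it. *)
Definition probe : cmd :=
  ((rset 14 (RSqrt (RAdd (RLit 1) (RMul (rvar 13) (rvar 13)))) ;;
    RSet 0 (NLit 0) (RDiv (RLit 1) (rvar 14)) ;;
    RSet 0 (NLit 1) (RDiv (rvar 13) (rvar 14)) ;;
    RSet 10 (nvar 18) (rvar 13) ;; incr 18 ;;
    rset 15 (RDiv (RAdd (RGet 3 (nvar 20)) (RMul (rvar 13) (snd_coord 20))) (rvar 14))) ;;
   (Query ;; (nset 23 (NLit 0) ;; count_events)))%cmd.

Definition slope_rexp (a b : nat) : rexp :=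
  RDiv (RSub (RLit 0) (RSub (RGet 3 (nvar a)) (RGet 3 (nvar b))))
       (RSub (snd_coord a) (snd_coord b)).

(* If e is the slope in array 11 itself, the term is 1, since 1 / 0 = 0. *)
Definition sep_rexp (e : rexp) : rexp :=
  let g := RDiv (RLit 1) (RSub e (rvar 11)) in RAdd (RLit 1) (RMul g g).

(** Cell 12 sums separation terms between the slope of the pair and, first, the slopes of all
    vertices with the vertex at pointer 20, then all stored slopes; its inverse is the perturbation.
    The vertex at pointer 20 itself enters with slope 0, as 0 / 0 = 0. *)
Definition test_pair : cmd :=
  ((rset 11 (slope_rexp 21 20) ;; rset 12 (RLit 1) ;; nset 22 (NLit 0)) ;;
   (For 11 19 (rset 12 (RAdd (rvar 12) (sep_rexp (slope_rexp 22 20))) ;;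
               nset 22 (NAdd (nvar 22) (nvar 0))) ;;
   (For 11 18 (rset 12 (RAdd (rvar 12) (sep_rexp (RGet 10 (nvar 11))))) ;;
   ((rset 12 (RDiv (RLit 1) (rvar 12)) ;; rset 13 (RAdd (rvar 11) (rvar 12))) ;;
   (probe ;;
   ((nset 24 (nvar 23) ;; rset 13 (RSub (rvar 11) (rvar 12))) ;;
   (probe ;;
   (If (BEqN (nvar 23) (nvar 24)) Skip
      (NSet 5 (nvar 25) (nvar 14) ;; NSet 6 (nvar 25) (nvar 13) ;; incr 25) ;;
    nset 21 (NAdd (nvar 21) (nvar 0))))))))))%cmd.

(** Array 0 still holds the generic direction and is cleared first. The inner counter stays below
    the outer one, so each unordered pair is tested once. *)
Definition find_edges : cmd :=
  (For 10 0 (RSet 0 (nvar 10) (RLit 0)) ;;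
   ((RSet 10 (NLit 0) (RLit 0) ;; RSet 10 (NLit 1) (rvar 6) ;;
     nset 18 (NLit 2) ;; nset 25 (NLit 0) ;; nset 20 (NLit 0)) ;;
   (For 13 19 (nset 21 (NLit 0) ;; (For 14 13 test_pair ;;
               nset 20 (NAdd (nvar 20) (nvar 0)))) ;;
    (NSet 4 (NLit 0) (nvar 19) ;; NSet 4 (NLit 1) (nvar 25)))))%cmd.

Section Edges.
Variables (R : realType) (d : nat) (G : egraph R d).
Variables (orc : 'rV[R]_d -> seq (dgm_point R)) (tau : 'rV[R]_d -> nat) (Tq : nat).
Local Notation n := (nv G).
Local Notation runs := (runs orc tau).
Implicit Types (m : memory R) (tr : seq 'rV[R]_d) (ts : seq R).

Lemma runs_count_events D m tr :
  holds_dgm D m -> (size D <= 4 * n ^ 2)%N -> nmem m 23%N 0%N = 0%N ->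
  runs count_events m tr (4 * n ^ 2 * 80 + 9)
    (fun m' tr' => tr' = tr /\
       nmem m' 23%N 0%N = count (edge_event (rmem m 15%N 0%N)) D).
Proof.
move=> [D1 D3 D2 R1 R2] szD n0; set h := rmem m 15%N 0%N.
pose I k (m' : memory R) (tr' : seq 'rV[R]_d) :=
  tr' = tr /\ nmem m' 23%N 0%N = count (edge_event h) (take k D).
apply: runs_weaken.
- rewrite /count_events; eapply (runs_for (I := I) (nb := size D)) => //.
  + by split=> //; rewrite take0.
  + move=> k m' tr' kD kE fr [trE E23]; apply: runs_flat => //.
    rewrite /I (take_nth (0, +oo%E, 0%N)) // -cats1 count_cat /= addn0.
    rewrite /edge_event kE !(frame_nmem (a := 3) _ fr) // !(frame_nmem (a := 2) _ fr) //.
    rewrite !(frame_rmem _ fr) // D3 // D2 // R1 // R2 // -/h.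
    case: eqP => _.
      by case: eqP => _; split=> //=; rewrite /upd /= E23 ?addn1 ?addn0.
    rewrite eqb0.
    by case: ifP => _; split=> //=; rewrite /upd /= E23 ?addn1 ?addn0.
- rewrite /=; lia.
by move=> m' tr' _; rewrite /I take_size.
Qed.

Hypothesis d1 : (1 < d)%N.
Let o0 := Ordinal (ltnW d1).
Let o1 := Ordinal d1.
Hypothesis orcP : apd_oracle G orc.
Hypothesis tauP : forall s, sphere s -> (tau s <= Tq)%N.

Lemma runs_probe m tr (v : 'I_n) (t := rmem m 13%N 0%N) (q := nmem m 18%N 0%N) :
  rmem m 3%N (nmem m 20%N 0%N) = pos v 0 o0 ->
  rmem m 3%N (nmem m 20%N 0%N).+1 = pos v 0 o1 ->
  (forall i, (1 < i < d)%N -> rmem m 0%N i = 0) ->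
  runs probe m tr (4 * n ^ 2 * 80 + Tq + 150)
    (fun m' tr' =>
       [/\ tr' = rcons tr (dir2 d t),
           nmem m' 23%N 0%N =
             count (edge_event (dot (pos v) (dir2 d t))) (orc (dir2 d t)),
           nmem m' 18%N 0%N = q.+1,
           (forall i, rmem m' 10%N i = if i == q then t else rmem m 10%N i) &
           forall i, (1 < i < d)%N -> rmem m' 0%N i = 0]).
Proof.
move=> xE yE E0; have ss := sphere_dir2 t d1.
apply: runs_budget.
- rewrite /probe; eapply (runs_seq (Q1 := fun m' tr' =>
    [/\ [/\ tr' = tr, rmem m' 0%N 0%N = 1 / dir2_norm t & rmem m' 0%N 1%N = t / dir2_norm t],
        nmem m' 18%N 0%N = q.+1,
        rmem m' 15%N 0%N = dot (pos v) (dir2 d t),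
        (forall i, rmem m' 10%N i = if i == q then t else rmem m 10%N i) &
        forall i, (1 < i < d)%N -> rmem m' 0%N i = 0])).
    apply: runs_flat => //; split; rewrite /= /upd /= -/t -/q.
    + by split.
    + by rewrite addn1.
    + by rewrite (dot_dir2 (o0 := o0) (o1 := o1)) // addn1 xE yE.
    + by [].
    by move=> [|[|i]] // /E0.
  move=> m1 tr1 fr1 [[-> E00 E01] E18 E15 E10 E0'].
  eapply (runs_seq (Q1 := fun m' tr' => tr' = rcons tr (dir2 d t) /\
     holds_dgm (orc (dir2 d t)) m')).
    apply: runs_query; [|exact: ss|exact: tauP|by split=> //; apply: load_dgmP].
    apply/rowP => -[[|[|i]] id]; rewrite !mxE //=.
    by rewrite E0'.
  move=> m2 tr2 fr2 [-> H2].
  eapply (runs_seq (Q1 := fun m' tr' => m' = setn m2 23 0 /\ tr' = rcons tr (dir2 d t))).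
    exact: runs_flat.
  move=> m3 tr3 _ [-> ->].
  eapply runs_weaken.
  * eapply (@runs_count_events (orc (dir2 d t))) => //; exact: size_orc.
  * exact: leqnn.
  move=> m4 tr4 fr4 [-> E23]; split=> //.
  + by rewrite E23 /= (frame_rmem _ fr2) // E15.
  + by rewrite (frame_nmem _ fr4) //= /upd /= (frame_nmem _ fr2).
  + by move=> i; rewrite (frame_rmem _ fr4) //= (frame_rmem _ fr2).
  by move=> i id; rewrite (frame_rmem _ fr4) //= (frame_rmem _ fr2) // E0'.
by rewrite /=; lia.
Qed.

Variables (phi : 'S_n) (eps : R) (tr0 : seq 'rV[R]_d).
Hypothesis gp : general_position G.

Definition has_coords m : Prop := forall (i : 'I_n) (j : 'I_d),
  rmem m 3%N (i * d + j)%N = pos (phi i) 0 j.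

(* [ts] are the slopes queried so far; the slopes 0 and [eps] stand for the
   first axis and, when d = 2, for the generic direction. *)
Definition slopes_done ts m tr : Prop :=
  [/\ tr = tr0 ++ [seq dir2 d t | t <- ts],
      nmem m 18%N 0%N = (size ts).+2,
      forall i, (i < (size ts).+2)%N -> rmem m 10%N i = nth 0 (0 :: eps :: ts) i,
      uniq (0 :: eps :: ts) &
      forall i, (1 < i < d)%N -> rmem m 0%N i = 0].

Lemma slopes_done_rcons ts t m tr m' tr' : slopes_done ts m tr ->
  t \notin 0 :: eps :: ts ->
  tr' = rcons tr (dir2 d t) -> nmem m' 18%N 0%N = (nmem m 18%N 0%N).+1 ->
  (forall i, rmem m' 10%N i = if i == nmem m 18%N 0%N then t else rmem m 10%N i) ->
  (forall i, (1 < i < d)%N -> rmem m' 0%N i = 0) ->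
  slopes_done (rcons ts t) m' tr'.
Proof.
move=> [trE E18 E10 uts E0] tn -> E18' E10' E0'; split=> //.
- by rewrite trE map_rcons rcons_cat.
- by rewrite E18' E18 size_rcons.
- move=> i; rewrite size_rcons -!rcons_cons nth_rcons E10' E18 ltnS leq_eqVlt /=.
  case: eqP => [-> _|_ /= ilt]; first by rewrite ltnn ?eqxx.
  by rewrite ilt E10.
by rewrite -!rcons_cons rcons_uniq tn.
Qed.

Lemma has_coords_frame ns rs m m' :
  frame ns rs m m' -> 3%N \notin rs -> has_coords m -> has_coords m'.
Proof. by move=> fr n3 H i j; rewrite (frame_rmem _ fr). Qed.

Lemma has_coords0 m (i : 'I_n) : has_coords m -> rmem m 3%N (i * d)%N = pos (phi i) 0 o0.
Proof. by move=> /(_ i o0) <-; rewrite addn0. Qed.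

Lemma has_coords1 m (i : 'I_n) : has_coords m -> rmem m 3%N (i * d).+1 = pos (phi i) 0 o1.
Proof. by move=> /(_ i o1) <-; rewrite addn1. Qed.

Local Notation sl := (fun u v : 'I_n => slope (xy o0 o1 u) (xy o0 o1 v)).
Local Notation edge i j := ([set phi i; phi j] \in edges G).

Lemma reval_slope m (i j : 'I_n) a b : has_coords m ->
  nmem m a 0%N = (i * d)%N -> nmem m b 0%N = (j * d)%N ->
  reval m (slope_rexp a b) = sl (phi i) (phi j).
Proof.
move=> H ai bj; rewrite /= ai bj !addn1 !has_coords0 // !has_coords1 //.
by rewrite sub0r.
Qed.

Definition sep (s t : R) : R := 1 + 1 / (s - t) * (1 / (s - t)).

Lemma sep_ge0 s t : 0 <= sep s t.
Proof. by rewrite /sep; nra. Qed.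

Lemma reval_sep m e : reval m (sep_rexp e) = sep (reval m e) (rmem m 11%N 0%N).
Proof. by []. Qed.

Lemma runs_test_pair ts m tr (i j : 'I_n) (e := nmem m 25%N 0%N) :
  (i < j)%N -> (size ts <= n ^ 2)%N ->
  nmem m 0%N 0%N = d -> nmem m 19%N 0%N = n ->
  nmem m 13%N 0%N = j -> nmem m 14%N 0%N = i ->
  nmem m 20%N 0%N = (j * d)%N -> nmem m 21%N 0%N = (i * d)%N ->
  has_coords m -> slopes_done ts m tr ->
  runs test_pair m tr (2 * (4 * n ^ 2 * 80 + Tq + 150) + 100 * n + 100 * n ^ 2 + 1000)
    (fun m' tr' => exists t1 t2,
       [/\ slopes_done (rcons (rcons ts t1) t2) m' tr',
           nmem m' 21%N 0%N = (i.+1 * d)%N,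
           nmem m' 25%N 0%N = (e + edge i j)%N,
           forall k, nmem m' 5%N k = if edge i j && (k == e) then i : nat else nmem m 5%N k &
           forall k, nmem m' 6%N k = if edge i j && (k == e) then j : nat else nmem m 6%N k]).
Proof.
move=> ij szt dE nE jE iE E20 E21 Hc sd.
set u := phi i; set v := phi j; set t := sl u v.
have uv : u != v by rewrite (inj_eq perm_inj); apply/eqP => /(congr1 val) /= h; lia.
pose I1 k (m' : memory R) (tr' : seq 'rV[R]_d) :=
  [/\ tr' = tr, nmem m' 22%N 0%N = (k * d)%N, 1 <= rmem m' 12%N 0%N &
      forall w : 'I_n, (w < k)%N -> sep (sl (phi w) v) t <= rmem m' 12%N 0%N].
pose I2 k (m' : memory R) (tr' : seq 'rV[R]_d) :=
  [/\ tr' = tr, 1 <= rmem m' 12%N 0%N,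
      forall w : 'I_n, sep (sl w v) t <= rmem m' 12%N 0%N &
      forall l, (l < k)%N -> sep (nth 0 (0 :: eps :: ts) l) t <= rmem m' 12%N 0%N].
apply: runs_budget.
- rewrite /test_pair; eapply (runs_seq (Q1 := fun m' tr' =>
    [/\ tr' = tr, rmem m' 11%N 0%N = t, rmem m' 12%N 0%N = 1 & nmem m' 22%N 0%N = 0%N])).
    apply: runs_flat => //; split=> //.
    by have := reval_slope Hc E21 E20.
  move=> m1 tr1 fr1 [-> E11 E12 E22].
  have Hc1 := has_coords_frame fr1 isT Hc.
  eapply (runs_seq (Q1 := I1 n)).
    eapply (runs_for (I := I1) (nb := n)) => //.
    + by rewrite (frame_nmem _ fr1).
    + by split; rewrite //= E12.
    move=> k m2 tr2 kn kE fr2 [-> E222 ge1 H2].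
    have Hc2 := has_coords_frame fr2 isT Hc1.
    have E202 : nmem m2 20%N 0%N = (j * d)%N.
      by rewrite (frame_nmem _ fr2) // (frame_nmem _ fr1).
    have E112 : rmem m2 11%N 0%N = t by rewrite (frame_rmem _ fr2).
    have E02 : nmem m2 0%N 0%N = d by rewrite (frame_nmem _ fr2) // (frame_nmem _ fr1).
    apply: runs_flat => //; split => //=; rewrite /upd //=.
    + by rewrite E222 E02 mulSn addnC.
    + rewrite -[X in _ <= _ + X]/(reval m2 (sep_rexp (slope_rexp 22 20))).
      by rewrite reval_sep; apply: ler_wpDr => //; apply: sep_ge0.
    rewrite -[X in _ + X]/(reval m2 (sep_rexp (slope_rexp 22 20))).
    rewrite reval_sep E112 (reval_slope (i := Ordinal kn) (j := j)) // -/v => w.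
    rewrite ltnS leq_eqVlt => /orP[/eqP wk|wk].
      have -> : w = Ordinal kn by apply: val_inj.
      by rewrite lerDr (le_trans ler01).
    by apply: ler_wpDr; [apply: sep_ge0 | apply: H2].
  move=> m2 tr2 fr2 [-> _ ge1 H2].
  have [trE E18 E10 uts E0] := sd.
  have E18' : nmem m2 18%N 0%N = (size ts).+2.
    by rewrite (frame_nmem _ fr2) // (frame_nmem _ fr1).
  eapply (runs_seq (Q1 := I2 (size ts).+2)).
    eapply runs_budget.
    * eapply (runs_for (I := I2) (nb := (size ts).+2)) => //.
      + split=> // w.
        by rewrite -(permKV phi w); apply: H2.
      move=> k m3 tr3 kn kE fr3 [-> ge1' H3 H3'].
      have E113 : rmem m3 11%N 0%N = t by rewrite (frame_rmem _ fr3) // (frame_rmem _ fr2).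
      have E103 : rmem m3 10%N k = nth 0 (0 :: eps :: ts) k.
        by rewrite (frame_rmem _ fr3) // (frame_rmem _ fr2) // (frame_rmem _ fr1) // E10.
      apply: runs_flat => //; rewrite /I2 /= /upd /= kE E113 E103.
      rewrite -/(sep (nth 0 (0 :: eps :: ts) k) t).
      have g0 := sep_ge0 (nth 0 (0 :: eps :: ts) k) t.
      split=> // [|w|l].
      + exact: ler_wpDr.
      + by apply: ler_wpDr.
      rewrite ltnS leq_eqVlt => /orP[/eqP ->|lk]; last by apply: ler_wpDr => //; apply: H3'.
      by rewrite lerDr (le_trans ler01).
    (* At most n^2 + 2 slopes are stored, so this loop costs O(n^2) per pair. *)
    * instantiate (1 := ((n ^ 2).+2 * 100 + 9)%N); rewrite /=; nia.
  move=> m3 tr3 fr3 [-> ge1' H3 H3'].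
  set D0 := rmem m3 12%N 0%N in ge1' H3 H3'.
  pose dl := 1 / D0.
  have dl0 : 0 < dl by rewrite divr_gt0 // (lt_le_trans ltr01).
  have dls (s : R) : sep s t <= D0 -> s != t -> dl < `|s - t|.
    by move=> le st; case: (small_step le _) => //; rewrite subr_eq0.
  (* A stored slope equals t or is farther than [dl] from it, so both perturbed slopes are new. *)
  have fresh (c : R) : `|c| = dl -> t + c \notin 0 :: eps :: ts.
    move=> cE; apply/negP => /(nthP 0)[l ls lE].
    have := dls _ (H3' l ls); rewrite lE -subr_eq0 addrAC subrr add0r cE ltxx.
    by rewrite -normr_gt0 cE dl0 => /(_ isT).
  have uniq2 : t - dl \notin 0 :: eps :: rcons ts (t + dl).
    rewrite -!rcons_cons mem_rcons inE negb_or fresh ?andbT; last first.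
      by rewrite normrN gtr0_norm.
    by rewrite lt_eqF // ltrD2l (lt_trans _ dl0) // oppr_lt0.
  eapply (runs_seq (Q1 := fun m' tr' =>
    [/\ tr' = tr, rmem m' 12%N 0%N = dl & rmem m' 13%N 0%N = t + dl])).
    apply: runs_flat => //; split => //=; rewrite /upd //=.
    by rewrite (frame_rmem (a := 11) _ fr3) // (frame_rmem (a := 11) _ fr2) // E11.
  move=> m4 tr4 fr4 [-> E124 E134].
  have Hc4 : has_coords m4.
    apply: has_coords_frame fr4 isT _; apply: has_coords_frame fr3 isT _.
    exact: has_coords_frame fr2 isT _.
  have nm4 a k : a \notin [:: 11%N; 22%N] -> nmem m4 a k = nmem m a k.
    rewrite !inE negb_or => /andP[/negbTE a1 /negbTE a2].
    have h : a \notin [:: 11%N; 22%N; 11%N] by rewrite !inE a1 a2.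
    rewrite (frame_nmem _ fr4) // (frame_nmem _ fr3) ?(frame_nmem _ fr2) ?(frame_nmem _ fr1) //=;
      by rewrite !inE ?a1 ?a2.
  have rm4 a k : a \notin [:: 11%N; 12%N; 13%N] -> rmem m4 a k = rmem m a k.
    rewrite !inE !negb_or => /and3P[/negbTE a1 /negbTE a2 /negbTE a3].
    rewrite (frame_rmem _ fr4) ?(frame_rmem _ fr3) ?(frame_rmem _ fr2) ?(frame_rmem _ fr1) //=;
      by rewrite !inE ?a1 ?a2 ?a3.
  have c0 : rmem m4 3%N (nmem m4 20%N 0%N) = pos v 0 o0 by rewrite nm4 // E20 has_coords0.
  have c1 : rmem m4 3%N (nmem m4 20%N 0%N).+1 = pos v 0 o1 by rewrite nm4 // E20 has_coords1.
  eapply runs_seq.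
    apply: (runs_probe _ c0 c1) => k kd; rewrite rm4 //; exact: E0.
  move=> m5 tr5 fr5 [trE5 E235 E185 E105 E05]; rewrite E134 in trE5 E235 E105.
  have sd4 : slopes_done ts m4 tr.
    split=> // [|k kts|k kd]; [by rewrite nm4 | by rewrite rm4 ?E10 | by rewrite rm4 ?E0].
  have sd5 := slopes_done_rcons sd4 (fresh dl (gtr0_norm dl0)) trE5 E185 E105 E05.
  eapply (runs_seq (Q1 := fun m' tr' =>
    [/\ tr' = tr5, nmem m' 24%N 0%N = nmem m5 23%N 0%N & rmem m' 13%N 0%N = t - dl])).
    apply: runs_flat => //; split=> //=; rewrite /upd /=.
    rewrite !(frame_rmem _ fr5) // E124.
    by rewrite (frame_rmem _ fr4) // (frame_rmem _ fr3) // (frame_rmem _ fr2) // E11.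
  move=> m6 tr6 fr6 [-> E246 E136].
  have E206 : nmem m6 20%N 0%N = (j * d)%N.
    by rewrite (frame_nmem _ fr6) // (frame_nmem _ fr5) // nm4.
  have Hc6 : has_coords m6.
    by apply: has_coords_frame fr6 isT _; apply: has_coords_frame fr5 isT _.
  have sd6 : slopes_done (rcons ts (t + dl)) m6 tr5.
    case: sd5 => a1 a2 a3 a4 a5; split=> // [|k|k kd].
    - by rewrite (frame_nmem _ fr6).
    - by rewrite (frame_rmem _ fr6) //; apply: a3.
    - by rewrite (frame_rmem _ fr6) // a5.
  have c06 : rmem m6 3%N (nmem m6 20%N 0%N) = pos v 0 o0 by rewrite E206 has_coords0.
  have c16 : rmem m6 3%N (nmem m6 20%N 0%N).+1 = pos v 0 o1 by rewrite E206 has_coords1.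
  eapply runs_seq.
    apply: (runs_probe _ c06 c16) => k kd; by case: sd6 => _ _ _ _; apply.
  move=> m7 tr7 fr7 [trE7 E237 E187 E107 E07]; rewrite E136 in trE7 E237 E107.
  have sd7 := slopes_done_rcons sd6 uniq2 trE7 E187 E107 E07.
  have E247 : nmem m7 24%N 0%N = nmem m5 23%N 0%N by rewrite (frame_nmem _ fr7).
  have nm7 a k : a \notin [:: 11%N; 22%N; 18%N; 1%N; 2%N; 3%N; 23%N; 24%N] ->
      nmem m7 a k = nmem m a k.
    rewrite !inE !negb_or.
    move=> /and5P[/negbTE a1 /negbTE a2 /negbTE a3 /negbTE a4].
    move=> /and4P[/negbTE a5 /negbTE a6 /negbTE a7 /negbTE a8].
    rewrite (frame_nmem _ fr7) ?(frame_nmem _ fr6) ?(frame_nmem _ fr5) ?nm4 //=;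
      by rewrite !inE ?a1 ?a2 ?a3 ?a4 ?a5 ?a6 ?a7 ?a8.
  have tst : (nmem m5 23%N 0%N != nmem m7 23%N 0%N) = edge i j.
    rewrite E235 E237; apply: (edge_test (o0 := o0) (o1 := o1)) => //.
    - by rewrite gt_eqF.
    - by move=> w; rewrite gtr0_norm //; apply: dls.
    - by apply: orcP; apply: sphere_dir2.
    - by apply: orcP; apply: sphere_dir2.
  apply: runs_flat => //; exists (t + dl), (t - dl).
  rewrite /= E247 eq_sym -[_ == _]negbK tst.
  have [a1 a2 a3 a4 a5] := sd7.
  case: (edge i j) => /=; split=> //; rewrite /upd /=.
  + by rewrite !nm7 // E21 dE mulSn addnC.
  + by rewrite nm7.
  + by move=> k; rewrite !nm7 // iE; case: eqP.
  + by move=> k; rewrite !nm7 // jE; case: eqP.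
  + by rewrite !nm7 // E21 dE mulSn addnC.
  + by rewrite nm7 // addn0.
  + by move=> k; rewrite !nm7.
  + by move=> k; rewrite !nm7.
rewrite /=; nia.
Qed.

(** Pairs are visited by their larger index and then by the smaller one; [L] collects the edges
    among the pairs visited before (i, j). *)
Definition edges_found (j i : nat) m : Prop := exists L : seq ('I_n * 'I_n),
  [/\ nmem m 25%N 0%N = size L,
      forall k, (k < size L)%N -> (nmem m 5%N k, nmem m 6%N k) =
        nth (0%N, 0%N) [seq (val p.1, val p.2) | p <- L] k,
      uniq L &
      forall p, (p \in L) = [&& (p.1 < p.2)%N,
        (p.2 < j)%N || (p.2 == j :> nat) && (p.1 < i)%N & edge p.1 p.2]].

Lemma edges_found_step (i j : 'I_n) m m' : (i < j)%N ->
  edges_found j i m ->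
  nmem m' 25%N 0%N = (nmem m 25%N 0%N + edge i j)%N ->
  (forall k, nmem m' 5%N k =
     if edge i j && (k == nmem m 25%N 0%N) then i : nat else nmem m 5%N k) ->
  (forall k, nmem m' 6%N k =
     if edge i j && (k == nmem m 25%N 0%N) then j : nat else nmem m 6%N k) ->
  edges_found j i.+1 m'.
Proof.
move=> ij [L [E25 EL uL mL]] E25' E5 E6.
have lex (p : 'I_n * 'I_n) : (p.1 < p.2)%N &&
    ((p.2 < j)%N || (p.2 == j :> nat) && (p.1 < i.+1)%N) =
    (p == (i, j)) || (p.1 < p.2)%N && ((p.2 < j)%N || (p.2 == j :> nat) && (p.1 < i)%N).
  case: p => a b /=; rewrite xpair_eqE -!val_eqE /=.
  move: (val a) (val b) (val i) (val j) ij => {}a {}b x y /=; lia.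
have mL' (p : 'I_n * 'I_n) : [&& (p.1 < p.2)%N, (p.2 < j)%N || (p.2 == j :> nat) && (p.1 < i.+1)%N
    & edge p.1 p.2] = (p == (i, j)) && edge i j || (p \in L).
  rewrite mL andbA lex andb_orl andbA; congr orb.
  by case: eqP => // ->.
case: (boolP (edge i j)) => eij in E25' E5 E6 mL'; last first.
  exists L; split=> // [|k kL|p]; first by rewrite E25' addn0.
    by rewrite E5 E6 EL.
  by rewrite mL' andbF.
exists (rcons L (i, j)); split=> [|k||p].
- by rewrite E25' addn1 size_rcons E25.
- rewrite size_rcons ltnS E5 E6 E25 map_rcons nth_rcons size_map leq_eqVlt /=.
  case: eqP => [-> _|_ /= kL]; first by rewrite ltnn.
  by rewrite kL EL.
- by rewrite rcons_uniq uL andbT mL /= ltnn eqxx ltnn /= !andbF.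
by rewrite mem_rcons inE mL' andbT.
Qed.

(** A pair with larger index j has its smaller index below j, so the row is complete once i reaches
    j. *)
Lemma edges_found_next j m : edges_found j j m -> edges_found j.+1 0 m.
Proof.
move=> [L [E25 EL uL mL]]; exists L; split=> // p; rewrite mL !andbA; congr andb.
by move: (val p.1) (val p.2) => /= a b; lia.
Qed.

Lemma edges_found_mem j i m m' : edges_found j i m ->
  nmem m' 25%N 0%N = nmem m 25%N 0%N ->
  (forall k, nmem m' 5%N k = nmem m 5%N k) ->
  (forall k, nmem m' 6%N k = nmem m 6%N k) -> edges_found j i m'.
Proof.
move=> [L [E25 EL uL mL]] E25' E5 E6; exists L; split=> // [|k kL].
  by rewrite E25'.
by rewrite E5 E6 EL.
Qed.

Lemma runs_find_edges m :
  nmem m 0%N 0%N = d -> nmem m 19%N 0%N = n -> rmem m 6%N 0%N = eps -> eps != 0 ->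
  has_coords m ->
  runs find_edges m tr0
    (d * 50 + n * (n * (2 * (4 * n ^ 2 * 80 + Tq + 150) +
       100 * n + 100 * n ^ 2 + 1100) + 100) + 100)
    (fun m' tr' => exists2 ts,
       [/\ tr' = tr0 ++ [seq dir2 d t | t <- ts], uniq (0 :: eps :: ts) &
           size ts = (n * n.-1)%N] &
       [/\ nmem m' 4%N 0%N = n, nmem m' 4%N 1%N = nmem m' 25%N 0%N,
           edges_found n 0 m' & has_coords m']).
Proof.
move=> dE nE E6 eps0 Hc.
(* Each of the j (j - 1) / 2 pairs of indices below j has used two queries. *)
pose I j (m' : memory R) (tr' : seq 'rV[R]_d) := exists ts,
  [/\ slopes_done ts m' tr', size ts = (j * j.-1)%N, nmem m' 20%N 0%N = (j * d)%N &
      edges_found j 0 m'].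
apply: runs_budget.
- rewrite /find_edges; eapply (runs_seq (Q1 := fun m' tr' => tr' = tr0 /\
    forall i, (i < d)%N -> rmem m' 0%N i = 0)).
    eapply (runs_for (nb := d) (I := fun k m' tr' => tr' = tr0 /\
      forall i, (i < k)%N -> rmem m' 0%N i = 0)) => //.
    move=> k m1 tr1 kd kE fr1 [-> H1]; apply: runs_flat => //; split=> //= i.
    by rewrite /upd /= kE ltnS leq_eqVlt; case: eqP => //= _; apply: H1.
  move=> m1 tr1 fr1 [-> E0].
  eapply (runs_seq (Q1 := I 0%N)).
    apply: runs_flat => //; exists [::]; split=> //=; last first.
      by exists [::]; split=> //= p; rewrite in_nil !ltn0 ?andbF /= ?andbF.
    split=> //=; rewrite ?cats0 //.
    + move=> [|[|i]] //= _; by rewrite /upd /= (frame_rmem _ fr1).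
    + by rewrite inE eq_sym eps0.
    by move=> i /andP[_ id]; apply: E0.
  move=> m2 tr2 fr2 I2.
  have Hc2 : has_coords m2.
    by apply: has_coords_frame fr2 isT _; apply: has_coords_frame fr1 isT _.
  eapply (runs_seq (Q1 := I n)).
    eapply (runs_for (nb := n) (I := I)) => //.
    + by rewrite (frame_nmem _ fr2) // (frame_nmem _ fr1).
    move=> j m3 tr3 jn jE fr3 [ts3 [sd3 szt3 E203 ef3]].
    have Hc3 := has_coords_frame fr3 isT Hc2.
    eapply (runs_seq (Q1 := fun m' tr' => m' = setn m3 21 0 /\ tr' = tr3)).
      exact: runs_flat.
    move=> m4 tr4 fr4 [m4E ->].
    pose J i (m' : memory R) (tr' : seq 'rV[R]_d) := exists ts,
      [/\ slopes_done ts m' tr', size ts = (j * j.-1 + 2 * i)%N,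
          nmem m' 21%N 0%N = (i * d)%N & edges_found j i m'].
    set Bp := (2 * (4 * n ^ 2 * 80 + Tq + 150) + 100 * n + 100 * n ^ 2 + 1000)%N.
    eapply (runs_seq (Q1 := J j)).
      apply: (runs_budget (B := (j * (Bp + 12) + 9)%N) (B' := (n * (Bp + 12) + 9)%N));
        last by rewrite leq_add2r leq_mul2r ltnW ?orbT.
      apply: (runs_for (nb := j) (I := J)) => //.
      * by rewrite (frame_nmem _ fr4).
      * by exists ts3; rewrite m4E; split=> //; rewrite szt3 muln0 addn0.
      move=> i m5 tr5 ij iE fr5 [ts5 [sd5 szt5 E215 ef5]].
      have i_n : (i < n)%N by apply: ltn_trans jn.
      eapply runs_weaken.
      * eapply (runs_test_pair (ts := ts5) (i := Ordinal i_n) (j := Ordinal jn)) => //.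
        - by rewrite szt5; case: (j) ij jn => // j' ij jn; nia.
        - by rewrite (frame_nmem _ fr5) // (frame_nmem _ fr4) // (frame_nmem _ fr3) //
            (frame_nmem _ fr2) // (frame_nmem _ fr1).
        - by rewrite (frame_nmem _ fr5) // (frame_nmem _ fr4) // (frame_nmem _ fr3) //
            (frame_nmem _ fr2) // (frame_nmem _ fr1).
        - by rewrite (frame_nmem _ fr5) // (frame_nmem _ fr4).
        - by rewrite (frame_nmem _ fr5) // (frame_nmem _ fr4).
        - by apply: has_coords_frame fr5 isT _; apply: has_coords_frame fr4 isT _.
      * exact: leqnn.
      move=> m6 tr6 fr6 [t1 [t2 [sd6 E216 E256 E56 E66]]].
      exists (rcons (rcons ts5 t1) t2); split=> //.
      - by rewrite !size_rcons szt5 mulnS; lia.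
      have := edges_found_step (i := Ordinal i_n) (j := Ordinal jn) ij ef5 E256 E56 E66.
      by move/edges_found_mem; apply.
    move=> m5 tr5 fr5 [ts5 [sd5 szt5 E215 ef5]].
    apply: runs_flat => //; exists ts5; split=> //.
    + by rewrite szt5; case: (j) => //= j'; lia.
    + rewrite /= /upd /= (frame_nmem _ fr5) // (frame_nmem (a := 20) _ fr4) // E203.
      rewrite (frame_nmem _ fr5) // (frame_nmem _ fr4) // (frame_nmem _ fr3) //.
      by rewrite (frame_nmem _ fr2) // (frame_nmem _ fr1) // dE mulSn addnC.
    by have := edges_found_next ef5; move/edges_found_mem; apply.
  move=> m3 tr3 fr3 [ts [sd szt _ ef]]; apply: runs_flat => //; exists ts.
    by case: sd => -> _ _ u _; split.
  split=> //=; rewrite /upd /=.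
  + by rewrite (frame_nmem _ fr3) // (frame_nmem _ fr2) // (frame_nmem _ fr1).
  exact: has_coords_frame fr3 isT Hc2.
rewrite /=; nia.
Qed.

(** An edge is a set of two vertices; ordering their indices under the inverse of [phi] singles out
    exactly one pair with [p.1 < p.2]. *)
Lemma edge_list L : uniq L ->
  (forall p : 'I_n * 'I_n, (p \in L) = [&& (p.1 < p.2)%N,
     (p.2 < n)%N || (p.2 == n :> nat) && (p.1 < 0)%N & edge p.1 p.2]) ->
  perm_eq [seq [set phi p.1; phi p.2] | p <- L] (enum (edges G)).
Proof.
move=> uL mL; have {}mL p : (p \in L) = (p.1 < p.2)%N && edge p.1 p.2.
  by rewrite mL ltn_ord.
apply: uniq_perm; last 1 first.
- move=> e; rewrite mem_enum; apply/mapP/idP => [[p + ->]|eG].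
    by rewrite mL => /andP[].
  have /eqP/cards2P[x [y [xy eE]]] := edges_card2 eG.
  have := eG; rewrite eE -{1}(permKV phi x) -{1}(permKV phi y) => eG'.
  set a := (phi^-1)%g x in eG'; set b := (phi^-1)%g y in eG'.
  have ab : a != b by rewrite (inj_eq perm_inj).
  case: (ltngtP a b) => [lt|lt|/val_inj h]; last by rewrite h eqxx in ab.
    by exists (a, b); rewrite ?mL /= ?lt ?eG' // !permKV //.
  exists (b, a); rewrite ?mL /= ?lt ?(setUC [set phi b]) ?eG' // !permKV //.
- rewrite map_inj_in_uniq // => -[a b] [a' b']; rewrite !mL /= => /andP[ab _] /andP[ab' _] E.
  have ina : phi a \in [set phi a'; phi b'] by rewrite -E !inE eqxx.
  have inb : phi b \in [set phi a'; phi b'] by rewrite -E !inE eqxx orbT.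
  move: ina inb ab; rewrite !inE !(inj_eq perm_inj).
  case/orP=> /eqP ->; case/orP=> /eqP ->; rewrite ?ltnn // => ba.
  by have := ltn_trans ba ab'; rewrite ltnn.
exact: enum_uniq.
Qed.

End Edges.

(** * The whole program and its running time *)

Definition reconstruct : cmd :=
  (query_axes ;; (sum_gaps ;; (query_generic ;; (decode_coords ;; find_edges))))%cmd.

Definition total_budget (d n Tq : nat) : nat :=
  (d * (4 * n ^ 2 * 50 + Tq + 50) + 20 +
   (d * (n * (n * 70 + 70) + 70) + 70 +
    (d * 100 + 4 * n ^ 2 * 50 + Tq + 200 +
     (n * (d * (n * 70 + 70) + 70) + 70 +
      (d * 50 + n * (n * (2 * (4 * n ^ 2 * 80 + Tq + 150) + 100 * n + 100 * n ^ 2 + 1100)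
         + 100) + 100)))))%N.

(** Each monomial of the budget is dominated by one of d n^3, n^4, d T and n^2 T, up to the factor
    c, and d > 1 gives n^3 <= n^(d + 1). The constant 4900 exceeds the sum of all coefficients free
    of c, which is 3820. *)
Lemma total_budget_le (d n c T : nat) : (1 < d)%N -> (0 < T)%N ->
  (total_budget d n (c * T) <=
   (4900 * (c + 1)) * (d * n ^ (d + 1) + n ^ 4 + (d + n ^ 2) * T))%N.
Proof.
move=> d1 T0.
have p3 : (d * (n * n * n) <= d * n ^ (d + 1))%N.
  rewrite leq_mul2l; apply/orP; right.
  have -> : (n * n * n = n ^ 3)%N by rewrite !expnS expn0 muln1 mulnA.
  case: n => [|n]; first by rewrite exp0n.
  by rewrite leq_pexp2l // addn1 ltnS.
set Y := (d * (n * n * n) + n * n * n * n + d * T + n * n * T)%N.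
have n4 : (n ^ 4 = n * n * n * n)%N by rewrite !expnS expn0 muln1 !mulnA.
have YX : (Y <= d * n ^ (d + 1) + n ^ 4 + (d + n ^ 2) * T)%N.
  by rewrite n4 -mulnn /Y; move: p3; move: (n ^ (d + 1))%N => p; nia.
apply: leq_trans (leq_mul (leqnn _) YX).
have h1 : (d <= d * T)%N by nia.
have h2 : (1 <= d * T)%N by nia.
have h3 : (d * (n * n) <= d * (n * n * n))%N by case: (n) => // k; nia.
have h4 : (d * n <= d * (n * n * n))%N by case: (n) => // k; nia.
have h5 : (n * n <= n * n * n * n)%N by case: (n) => // k; nia.
have h6 : (n <= n * n * n * n)%N by case: (n) => // k; nia.
have h7 : (n * n * n <= n * n * n * n)%N by case: (n) => // k; nia.
have h8 : (T <= d * T)%N by nia.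
have cY a : (a <= Y)%N -> (c * a <= c * Y)%N by move=> ?; rewrite leq_mul2l; apply/orP; right.
have k1 : (c * (d * T) <= c * Y)%N by apply: cY; rewrite /Y; lia.
have k2 : (c * (n * n * T) <= c * Y)%N by apply: cY; rewrite /Y; lia.
have k3 : (c * T <= c * Y)%N by apply: cY; rewrite /Y; lia.
have -> : (4900 * (c + 1) * Y = 4900 * (c * Y) + 4900 * Y)%N by lia.
have l0 : (d * T <= Y)%N by rewrite /Y; lia.
have l1 : (d * (n * n * n) <= Y)%N by rewrite /Y; lia.
have l2 : (n * n * n * n <= Y)%N by rewrite /Y; lia.
have -> : (total_budget d n (c * T) = 340 * (d * (n * n)) + c * (d * T) + 270 * d + 460 +
    140 * (d * n) + 1600 * (n * n) + c * T + 170 * n + 740 * (n * n * n * n) +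
    2 * (c * (n * n * T)) + 100 * (n * n * n))%N.
  by rewrite /total_budget -!mulnn; ring.
clear cY YX p3 n4; clearbody Y.
(* With the monomials generalized to atoms, the goal is linear. *)
move: (n * n)%N (n * n * n)%N (n * n * n * n)%N (d * n)%N (d * (n * n))%N
  (d * (n * n * n))%N (d * T)%N (c * Y)%N (c * T)%N (c * (n * n * T))%N (c * (d * T))%N
  k1 k2 k3 l0 l1 l2 h1 h2 h3 h4 h5 h6 h7 h8; lia.
Qed.

(* A single program works for all dimensions and graphs, and the constant [C]
   of the time bound depends only on the constants [c1], [c2] hidden in the
   assumption that an oracle call takes time Theta(T). *)
Theorem mainTheorem2 (R : realType) :
  exists P : cmd, forall c1 c2 : nat, exists C : nat,
  forall (d : nat) (G : egraph R d) (orc : 'rV[R]_d -> seq (dgm_point R))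
         (T : nat) (tau : 'rV[R]_d -> nat),
    let n := nv G in
    (1 < d)%N ->
    general_position G ->
    apd_oracle G orc ->
    (0 < T)%N ->
    (forall s, sphere s -> (T <= c1 * tau s)%N /\ (tau s <= c2 * T)%N) ->
    exists (m : memory R) (tr : seq 'rV[R]_d) (t : nat),
      [/\ exec orc tau P (init_mem R d) m tr t,
          reconstructs G m,
          uniq tr,
          size tr = (n ^ 2 - n + d + 1)%N &
          (t <= C * (d * n ^ (d + 1) + n ^ 4 + (d + n ^ 2) * T))%N].
Proof.
exists reconstruct => c1 c2; exists (4900 * (c2 + 1))%N.
move=> d G orc T tau n d1 gp orcP T0 tauP'.
have tauP s : sphere s -> (tau s <= c2 * T)%N by move=> /tauP' [].
suff [m [tr [t [ex tB [rec utr str]]]]] : runs orc tau reconstruct (init_mem R d) [::]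
    (total_budget d n (c2 * T))
    (fun m tr => [/\ reconstructs G m, uniq tr & size tr = (n ^ 2 - n + d + 1)%N]).
  exists m, tr, t; split=> //.
  by apply: leq_trans tB _; apply: total_budget_le.
rewrite /reconstruct /total_budget; eapply runs_seq.
  by apply: (runs_query_axes d1 orcP tauP).
move=> m1 tr1 fr1 [-> E19 E12 tab].
have E0 : nmem m1 0%N 0%N = d by rewrite (frame_nmem _ fr1).
eapply runs_seq.
  exact: (runs_sum_gaps orc tau).
move=> m2 tr2 fr2 [-> E15 gaps].
set S := rmem m2 5%N 0%N in gaps; pose eps := (2 + 4 * S * S)^-1.
have E02 : nmem m2 0%N 0%N = d by rewrite (frame_nmem _ fr2).
have E122 : nmem m2 12%N 0%N = (d * n)%N by rewrite (frame_nmem _ fr2).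
eapply runs_seq.
  by apply: (runs_query_generic d1 orcP tauP).
move=> m3 tr3 fr3 [-> E193 [E63 E83 E93] E43 E43'].
have E53 : rmem m3 5%N 0%N = S by rewrite (frame_rmem _ fr3).
(* The generic births were written from cell d n on, so the coordinate tables are unchanged. *)
have f4 i : (i < d * n)%N -> rmem m3 4%N i = rmem m1 4%N i.
  by move=> id; rewrite E43' // (frame_rmem _ fr2).
have blk j c : (j < d)%N -> (c < n)%N -> (j * n + c < d * n)%N.
  move=> jd cn; apply: (@leq_trans (j.+1 * n)); last by rewrite leq_mul2r jd orbT.
  by rewrite mulSn addnC ltn_add2r.
eapply runs_seq.
  eapply (runs_decode tau d1 orcP) => //; rewrite ?E53.
  - by rewrite (frame_nmem _ fr3).
  - by rewrite (frame_nmem _ fr3).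
  - move=> j; have [h1 h2] := tab j; split=> [v|c cn].
      by have [c cn cE] := h1 v; exists c => //; rewrite f4 // blk.
    by have [v vE] := h2 c cn; exists v; rewrite f4 // blk.
  - case: gaps => S0 gaps; split=> // j a b an bn jd.
    (* For j = d the order condition would need an index below 0, so only the preserved blocks are
       read. *)
    have jd' : (j < d)%N by move: jd; rewrite !ltn0 !andbF orbF; lia.
    by have := gaps j a b an bn jd; rewrite /gap_value !f4 ?blk.
  - exact: E83.
  - exact: E93.
  - exact: E43.
move=> m4 tr4 fr4 [-> [phi phiE]].
eapply runs_weaken.
- eapply (runs_find_edges (phi := phi) (eps := eps) d1 orcP tauP) => //.
  + by rewrite (frame_nmem _ fr4) // (frame_nmem _ fr3).
  + by rewrite (frame_nmem _ fr4).
  + by rewrite (frame_rmem _ fr4).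
  have [S0 _] := gaps; rewrite invr_eq0 gt_eqF //; nra.
- exact: leqnn.
move=> m5 tr5 fr5 [ts [trE uts sts] [En Ee [L [EL cells uL mL]] Hc]].
rewrite trE cat0s; split.
- split; first exact: En.
  exists phi; split; first exact: Hc.
  exists L; split; [by rewrite Ee | exact: cells | exact: edge_list].
- rewrite uniq_queries // invr_eq0 gt_eqF //.
  by have [S0 _] := gaps; nra.
(* There are d axes, one generic direction and n (n - 1) slopes. *)
rewrite size_cat size_rcons !size_map size_iota sts -mulnn.
by rewrite -/n; case: (n) => [|k] /=; nia.
Qed.
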